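(* Let $R$ be a noetherian commutative ring, $S$ a multiplicative set of $R$ consisting of non-zero-divisors, and assume there is an integer $d(R)$ such that $\mathrm{Ext}^i_R(M,R)=0$ for all $i>d(R)$ and all finitely generated $R$-modules $M$. Let $\mathcal{F}=\mathrm{Fitt}_R:\mathcal{C}\to\Omega$. Then for every $M\in\mathcal{C}$, \[ \mathcal{F}^{\langle-2\rangle}(M)=\mathcal{F}(M^* ). \]
   Context: $\mathcal M$ is the category of finitely generated $S$-torsion $R$-modules; $\mathcal C=\{M\in\mathcal M\mid\mathrm{Ext}^i_R(M,R)=0\text{ for all }i\ge2\}$; $\mathcal P=\{P\in\mathcal M\mid\mathrm{pd}_R(P)\le1\}$. $M^*=\mathrm{Ext}^1_R(M,R)$, which lies in $\mathcal C$ for $M\in\mathcal C$. $\mathrm{Fitt}_R$ is the initial Fitting ideal, and $\Omega$ is the commutative monoid of finitely generated $R$-submodules of $S^{-1}R$ under multiplication; $\mathcal F(P)$ is invertible in $\Omega$ for $P\in\mathcal P$. For $M\in\mathcal C$, $\mathcal F^{\langle-2\rangle}(M)$ is defined by taking an exact sequence $0\to M\to P_2\to P_1\to N\to0$ with $N\in\mathcal C$, $P_1,P_2\in\mathcal P$ (and image of $P_2\to P_1$ in $\mathcal C$) and putting $\mathcal F^{\langle-2\rangle}(M)=\mathcal F(P_1)^{-1}\mathcal F(P_2)\mathcal F(N)$; such a sequence exists and the value is independent of its choice. *)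

(* Defs.v *)
From HB Require Import structures.
From mathcomp Require Import all_boot all_order all_algebra generic_quotient.
From mathcomp Require Import ring_quotient finmap.
From mathcomp Require Import boolp classical_sets functions cardinality fsbigop.

Set Implicit Arguments.
Unset Strict Implicit.
Unset Printing Implicit Defensive.

Import GRing.Theory.
Local Open Scope classical_set_scope.
Local Open Scope ring_scope.

Record submod (R : pzRingType) (V : lmodType R) := Submod {
  submod_pred :> {pred V};
  submod_closedP : submod_closed submod_pred }.

HB.instance Definition _ (R : pzRingType) (V : lmodType R) (W : submod V) :=
  GRing.isSubmodClosed.Build R V (submod_pred W) (submod_closedP W).

Definition subm (R : pzRingType) (V : lmodType R) (W : submod V) : Type :=
  {x : V | x \in submod_pred W}.

Section Subm.
Variables (R : pzRingType) (V : lmodType R) (W : submod V).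
HB.instance Definition _ := SubChoice.on (subm W).
HB.instance Definition _ :=
  [SubChoice_isSubLmodule of subm W by <:].

Definition in_subm (v : V) (vW : v \in submod_pred W) : subm W :=
  exist (fun x => x \in submod_pred W) v vW.
End Subm.

Definition quotm (R : pzRingType) (V : lmodType R) (W : submod V) : Type :=
  Quotient.quot (submod_pred W).

Section Quotm.
Variables (R : pzRingType) (V : lmodType R) (W : submod V).
Local Open Scope quotient_scope.
Import Quotient.

HB.instance Definition _ := GRing.Zmodule.on (quotm W).

Definition projm (v : V) : quotm W := \pi_(Quotient.quot (submod_pred W)) v.
Definition scaleq (a : R) (x : quotm W) : quotm W :=
  projm (a *: repr (x : Quotient.quot (submod_pred W))).

Lemma projm_eq u v : (projm u = projm v) <-> u - v \in submod_pred W.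
Proof.
by rewrite Quotient.idealrBE; split=> [|/eqP//]; rewrite /projm => ->.
Qed.

Lemma projm_surj x : exists v, x = projm v.
Proof.
exists (repr (x : Quotient.quot (submod_pred W))).
by rewrite /projm reprK.
Qed.

Lemma projmD u v : projm (u + v) = projm u + projm v.
Proof. exact: (raddfD \pi_(Quotient.quot (submod_pred W))). Qed.

Lemma scaleqE a v : scaleq a (projm v) = projm (a *: v).
Proof.
apply/projm_eq; rewrite -scalerBr rpredZ//.
by apply/projm_eq; rewrite /projm reprK.
Qed.

Fact scaleqA a b x : scaleq a (scaleq b x) = scaleq (a * b) x.
Proof. by have [v ->] := projm_surj x; rewrite !scaleqE scalerA. Qed.
Fact scale1q : left_id 1 scaleq.
Proof. by move=> x; have [v ->] := projm_surj x; rewrite scaleqE scale1r. Qed.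
Fact scaleqDr : right_distributive scaleq +%R.
Proof.
move=> a x y; have [u ->] := projm_surj x; have [v ->] := projm_surj y.
by rewrite -projmD !scaleqE scalerDr projmD.
Qed.
Fact scaleqDl x : {morph scaleq^~ x : a b / a + b}.
Proof.
by move=> a b /=; have [v ->] := projm_surj x; rewrite !scaleqE scalerDl projmD.
Qed.
HB.instance Definition _ := GRing.Zmodule_isLmodule.Build R (quotm W)
  scaleqA scale1q scaleqDr scaleqDl.

Fact projm_is_linear : linear projm.
Proof. by move=> a u v; rewrite projmD -scaleqE. Qed.
HB.instance Definition _ := GRing.isLinear.Build R V (quotm W) *:%R projm
  projm_is_linear.
End Quotm.

Section Homological.
Variable R : pzRingType.
Implicit Types A B C M N P V : lmodType R.

Definition surjective (A B : Type) (f : A -> B) := forall b, exists a, f a = b.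

Definition exact_at A B C (f : {linear A -> B}) (g : {linear B -> C}) :=
  forall b, g b = 0 <-> exists a, f a = b.

Definition zero_mod M := forall m : M, m = 0.

Definition projective P :=
  forall (A B : lmodType R) (g : {linear A -> B}) (f : {linear P -> B}),
    surjective g -> exists h : {linear P -> A}, forall x, g (h x) = f x.

Fact kernel_closed A B (f : {linear A -> B}) :
  submod_closed [pred a | `[< f a = 0 >]].
Proof.
split=> [|k u v]; first by apply/asboolP; rewrite linear0.
move=> /asboolP fu /asboolP fv; apply/asboolP.
by rewrite linearP fu fv scaler0 addr0.
Qed.
Definition kernel A B (f : {linear A -> B}) := Submod (kernel_closed f).

Fact image_closed A B (f : {linear A -> B}) :
  submod_closed [pred b | `[< exists a, f a = b >]].
Proof.
split=> [|k u v]; first by apply/asboolP; exists 0; rewrite linear0.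
move=> /asboolP[a <-] /asboolP[b <-]; apply/asboolP.
by exists (k *: a + b); rewrite linearP.
Qed.
Definition image_mod A B (f : {linear A -> B}) := Submod (image_closed f).

Record projres M := ProjRes {
  pr_mod : nat -> lmodType R;
  pr_d : forall i, {linear pr_mod i.+1 -> pr_mod i};
  pr_aug : {linear pr_mod 0 -> M};
  pr_projective : forall i, projective (pr_mod i);
  pr_aug_surj : surjective pr_aug;
  pr_aug_exact : exact_at (pr_d 0) pr_aug;
  pr_d_exact : forall i, exact_at (pr_d i.+1) (pr_d i) }.

Definition pd_le (n : nat) M :=
  exists r : projres M, forall i, (n < i)%N -> zero_mod (pr_mod r i).

End Homological.

(* The free module on T is the module of functions T -> R with finite
   support. *)

Section Free.
Variables (R : pzRingType) (T : choiceType).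

Fact finsupp_closed :
  submod_closed [pred f : T -> R^o | `[< finite_set [set t | f t != 0] >]].
Proof.
split=> [|k u v].
  apply/asboolP; apply: sub_finite_set (@finite_set0 T) => t.
  by move=> /eqP.
move=> /asboolP fu /asboolP fv; apply/asboolP.
have : finite_set ([set t | u t != 0] `|` [set t | v t != 0]).
  by rewrite finite_setU.
apply: sub_finite_set => t /=; have [ut0|] := eqVneq (u t) 0; last by left.
have [vt0|] := eqVneq (v t) 0; last by right.
suff -> : (k *: u + v) t = 0 by rewrite eqxx.
by rewrite -[LHS]/(k *: u t + v t) ut0 vt0 scaler0 addr0.
Qed.

Definition free_mod : lmodType R := subm (Submod finsupp_closed).

Definition free_coef (f : free_mod) (t : T) : R := val f t.

Lemma free_coef_finite (f : free_mod) : finite_set [set t | free_coef f t != 0].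
Proof. by have /asboolP := valP f. Qed.

Definition free_supp (f : free_mod) : {fset T} :=
  fset_set [set t | free_coef f t != 0].

Lemma mem_free_supp f t : (t \in free_supp f) = (free_coef f t != 0).
Proof.
rewrite /free_supp in_fset_set; last exact: free_coef_finite.
exact/asboolP/idP.
Qed.

Fact basis_subproof (t : T) :
  (fun u => (u == t)%:R : R^o) \in Submod finsupp_closed.
Proof.
apply/asboolP; apply: sub_finite_set (@finite_set1 T t) => u /=.
by case: (eqVneq u t) => [->|_ /eqP].
Qed.
Definition free_basis (t : T) : free_mod := in_subm (basis_subproof t).

Variables (A : lmodType R) (a : T -> A).

Definition free_eval (f : free_mod) : A :=
  \sum_(t <- free_supp f) free_coef f t *: a t.

Lemma free_evalE (X : {fset T}) (f : free_mod) :
  (forall t, free_coef f t != 0 -> t \in X) ->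
  free_eval f = \sum_(t <- X) free_coef f t *: a t.
Proof.
move=> fX; apply: big_fset_incl => [|t _].
  by apply/fsubsetP => t; rewrite mem_free_supp; exact: fX.
by rewrite mem_free_supp => /negPn/eqP ->; rewrite scale0r.
Qed.

Fact free_eval_linear : linear free_eval.
Proof.
move=> k f g.
pose X := (free_supp f `|` free_supp g)%fset.
have fX t : free_coef f t != 0 -> t \in X.
  by rewrite in_fsetU mem_free_supp => ->.
have gX t : free_coef g t != 0 -> t \in X.
  by rewrite in_fsetU !mem_free_supp orbC => ->.
have kE t : free_coef (k *: f + g) t = k * free_coef f t + free_coef g t.
  by [].
rewrite (free_evalE fX) (free_evalE gX) (@free_evalE X); last first.
  move=> t; rewrite kE; have [->|/fX//] := eqVneq (free_coef f t) 0.
  by rewrite mulr0 add0r => /gX.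
rewrite scaler_sumr -big_split/=; apply: eq_bigr => t _.
by rewrite kE scalerDl scalerA.
Qed.
HB.instance Definition _ := GRing.isLinear.Build R free_mod A *:%R free_eval
  free_eval_linear.

Lemma free_eval_basis t : free_eval (free_basis t) = a t.
Proof.
have bE u : free_coef (free_basis t) u = (u == t)%:R by [].
rewrite (@free_evalE [fset t]%fset) => [|u].
  by rewrite big_seq_fset1 bE eqxx scale1r.
by rewrite bE inE; case: (eqVneq u t) => [_|_ /eqP].
Qed.
End Free.

Lemma free_modE (R : pzRingType) (T : choiceType) (f : free_mod R T) :
  f = \sum_(t <- free_supp f)
        free_coef f t *: free_basis R t.
Proof.
apply: val_inj; apply/funext => u; rewrite -[LHS]/(free_coef f u).
rewrite -[RHS]/(free_coef _ u).
rewrite (big_morph (fun g : free_mod R T => free_coef g u)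
  (id1 := 0) (op1 := +%R))//.
have E t : free_coef (free_coef f t *: free_basis R t) u
         = free_coef f t * (u == t)%:R by [].
under eq_bigr do rewrite E.
have [fu0|fu] := eqVneq (free_coef f u) 0.
  rewrite big1 // => t _; have [<-|] := eqVneq u t; last by rewrite mulr0.
  by rewrite fu0 mul0r.
rewrite (big_fsetD1 u) ?mem_free_supp//=.
rewrite eqxx mulr1 big1_fset ?addr0// => t; rewrite !inE => /andP[tu _] _.
by rewrite eq_sym (negbTE tu) mulr0.
Qed.

Lemma free_projective (R : pzRingType) (T : choiceType) :
  projective (free_mod R T).
Proof.
move=> A B g f gsurj.
have /boolp.choice[a ga] : forall t, exists x, g x = f (free_basis R t).
  by move=> t; exact: gsurj.
exists (free_eval a) => x.
rewrite [in RHS](free_modE x) /free_eval !linear_sum; apply: eq_bigr => t _.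
by rewrite !linearZ_LR ga.
Qed.

(* Standard free resolution of M: in degree n, the free module on the
   underlying set of the n-th syzygy. *)

Section FreeResolution.
Variables (R : pzRingType) (M : lmodType R).

Definition free_cover (N : lmodType R) : {linear free_mod R N -> N} :=
  free_eval (@id N).

Lemma free_cover_surj (N : lmodType R) : surjective (free_cover N).
Proof. by move=> x; exists (free_basis R x); exact: free_eval_basis. Qed.

Fixpoint syzygy (n : nat) : lmodType R :=
  if n is m.+1 then subm (kernel (free_cover (syzygy m))) else M.

Definition syzygy_d (n : nat) :
    {linear free_mod R (syzygy n.+1) -> free_mod R (syzygy n)} :=
  (val : subm (kernel (free_cover (syzygy n))) -> _)
    \o free_cover (syzygy n.+1).

Lemma syzygy_exact (n : nat) : exact_at (syzygy_d n) (free_cover (syzygy n)).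
Proof.
move=> b; split=> [b0|[x <-]]; last exact/asboolP/(valP (free_cover _ x)).
have kb : b \in kernel (free_cover (syzygy n)) by exact/asboolP.
have [x xb] := free_cover_surj (in_subm kb).
by exists x; rewrite /syzygy_d/= xb SubK.
Qed.

Lemma syzygy_d_exact (n : nat) : exact_at (syzygy_d n.+1) (syzygy_d n).
Proof.
move=> b; rewrite -(syzygy_exact b); split=> [b0|b0].
  by apply: val_inj; rewrite raddf0.
by rewrite /syzygy_d/= b0.
Qed.

Definition free_res : projres M :=
  @ProjRes R M (fun n => free_mod R (syzygy n)) syzygy_d (free_cover M)
    (fun n => @free_projective R (syzygy n)) (@free_cover_surj M)
    (@syzygy_exact 0) (@syzygy_d_exact).
End FreeResolution.

(* ext_res r i is H^i(Hom(P, N)) for the projective resolution P = r of M;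
   Hom(P_i, N) is not a type of its own: linearity is part of cocycle. *)

Section Ext.
Variables (R : comPzRingType) (M N : lmodType R).

Section Cohomology.
Variables (r : projres M) (i : nat).

Fact cocycle_closed : submod_closed
  [pred f : pr_mod r i -> N | `[< linear f /\ forall x, f (pr_d r i x) = 0 >]].
Proof.
split=> [|k u v].
  by apply/asboolP; split=> // a x y; rewrite /GRing.zero/= scaler0 addr0.
move=> /asboolP[lu du] /asboolP[lv dv]; apply/asboolP.
have E x : (k *: u + v) x = k *: u x + v x by [].
split=> [a x y|x]; last by rewrite E du dv scaler0 addr0.
rewrite !E lu lv !scalerDr !scalerA (mulrC a k).
by rewrite !addrA; congr (_ + _); rewrite addrAC.
Qed.
Definition cocycle := Submod cocycle_closed.

Definition is_coboundary : (pr_mod r i -> N) -> Prop :=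
  match i return (pr_mod r i -> N) -> Prop with
  | 0 => fun f => f = 0
  | j.+1 => fun f => exists g : {linear pr_mod r j -> N}, f = g \o pr_d r j
  end.

Fact coboundary_closed :
  submod_closed [pred f : pr_mod r i -> N | `[< is_coboundary f >]].
Proof.
rewrite /is_coboundary; case: i => [|j]; split=> [|k u v].
- exact/asboolP.
- by move=> /asboolP-> /asboolP->; apply/asboolP; rewrite scaler0 addr0.
- by apply/asboolP; exists \0.
- move=> /asboolP[g ->] /asboolP[h ->]; apply/asboolP.
  by exists (k \*: g \+ h).
Qed.
Definition coboundary := Submod coboundary_closed.

Fact coboundary_cocycle_closed :
  submod_closed [pred f : subm cocycle | val f \in coboundary].
Proof.
split=> [|k u v uB vB]; first exact: (rpred0 coboundary).
suff : val (k *: u + v) \in submod_pred coboundary by [].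
rewrite (_ : val (k *: u + v) = k *: val u + val v)//.
by rewrite rpredD ?rpredZ.
Qed.

Definition ext_res : lmodType R := quotm (Submod coboundary_cocycle_closed).
End Cohomology.

Definition Ext (i : nat) : lmodType R := ext_res (free_res M) i.
End Ext.

Section Modules.
Variable R : comPzRingType.
Implicit Types M N P : lmodType R.

Definition generates M n (x : 'I_n -> M) :=
  forall m, exists c : 'I_n -> R, m = \sum_i c i *: x i.

Definition fg_mod M := exists n (x : 'I_n -> M), generates x.

Definition dual M : lmodType R := Ext M R^o 1.

(* The R-submodule of K generated by G, for a ring morphism iota : R -> K *)
Definition Rspan (K : comPzRingType) (iota : {rmorphism R -> K}) (G : set K) :
    set K :=
  [set z | exists n (c : 'I_n -> R) (g : 'I_n -> K),
     (forall i, G (g i)) /\ z = \sum_i iota (c i) * g i].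

Definition noetherian := forall I : submod R^o, fg_mod (subm I).

(* The ideal of n x n minors of the matrix of all relations between the x i *)
Definition minors_ideal M n (x : 'I_n -> M) : set R :=
  Rspan idfun [set a | exists A : 'M[R]_n,
    (forall i, \sum_j A i j *: x j = 0) /\ a = \det A].

(* Any finite generating family gives the same ideal, by Fitting's lemma. *)
Definition Fitt M : set R :=
  get [set I | exists n (x : 'I_n -> M), generates x /\ I = minors_ideal x].

Section Torsion.
Variable S : set R.

Definition mult_set := S 1 /\ forall s t, S s -> S t -> S (s * t).

Definition nonzerodiv_set := forall s x, S s -> s * x = 0 -> x = 0.

Definition torsion_mod M := forall m : M, exists2 s, S s & s *: m = 0.

Definition catM M := fg_mod M /\ torsion_mod M.

Definition catC M := catM M /\ forall i, (2 <= i)%N -> zero_mod (Ext M R^o i).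

Definition catP P := catM P /\ pd_le 1 P.

Variables (K : comPzRingType) (iota : {rmorphism R -> K}).

(* K is a model of the ring of fractions of R with denominators in S *)
Definition is_localization :=
  [/\ forall s, S s -> exists k, iota s * k = 1,
      forall z, exists r s, S s /\ z * iota s = iota r
    & forall r, iota r = 0 -> exists2 s, S s & s * r = 0].

Definition Omega (X : set K) :=
  exists n (x : 'I_n -> K), X = Rspan iota (range x).

Definition Omega1 : set K := range iota.

Definition OmegaM (X Y : set K) : set K :=
  Rspan iota [set x * y | x in X & y in Y].

Definition Omega_inv (X X' : set K) := Omega X' /\ OmegaM X X' = Omega1.

Definition fracFitt M : set K := iota @` Fitt M.

(* X is the value F(P1)^-1 F(P2) F(N) given by some exact sequence
   0 -> M -> P2 -> P1 -> N -> 0 *)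
Definition shift2_value (F : lmodType R -> set K) M (X : set K) :=
  exists (P2 P1 N : lmodType R)
    (f : {linear M -> P2}) (g : {linear P2 -> P1}) (h : {linear P1 -> N}),
    [/\ injective f, exact_at f g, exact_at g h & surjective h] /\
    [/\ catP P2, catP P1, catC N & catC (subm (image_mod g))] /\
    exists J, Omega_inv (F P1) J /\ X = OmegaM (OmegaM J (F P2)) (F N).

(* F^<-2>(M): the common value of all these expressions *)
Definition shift2 (F : lmodType R -> set K) M : set K :=
  get [set X | shift2_value F M X /\ forall Y, shift2_value F M Y -> Y = X].

End Torsion.
End Modules.

(* Main.v *)
(* Write P1 = R^n / L1 and P2 = R^m / L2 with L1, L2 projective, and let C be
   a matrix lifting P2 -> P1.  For a submodule G of K^m let delta G be the
   submodule of K spanned by the determinants of m-tuples in G.  Then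
   Fitt(Pi) = delta Li and Fitt(N) = delta (L1 + R^m C).  Since L1, L2 have dual
   bases, delta Li is invertible with inverse delta of the dual lattice Li^v;
   this replaces localization to the free case.

   Since Ext^2(N, R) = Ext^2(im (P2 -> P1), R) = 0, dualizing shows that
   M' = Ext^1(M, R) is L2^v / G with G = R^m + C L1^v, whence
   Fitt(M') = delta(G) delta(L2).  Up to the factor delta(L1), both delta (L1 + R^m C) and delta G are spanned
   by the minors of one matrix over K, so Fitt(N) = delta(L1) delta(G), and the
   formula follows.

   For the existence of the four-term sequence, take s in S killing M; the
   generators of M' = Hom(M, R/s) define a map from M to some (R/s)^k, whose
   cokernel has no Ext^2 because (R/s)^k dualizes onto M'.  It is injective
   because M is reflexive: far enough to the right, the dual of a free
   resolution of M is itself the beginning of a free resolution of a finitely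
   generated module, whose high Ext vanish.  Doing this twice gives the
   sequence. *)
Require Import Defs.
From HB Require Import structures.
From mathcomp Require Import all_boot all_order all_algebra.
From mathcomp Require Import perm fingroup.
From mathcomp Require Import boolp classical_sets.

Set Implicit Arguments.
Unset Strict Implicit.
Unset Printing Implicit Defensive.

Import GRing.Theory.
Local Open Scope ring_scope.

(** * Spans over R inside K *)

Section Rspan.
Variables (R K : comPzRingType) (iota : {rmorphism R -> K}).
Implicit Types (G T X Y Z : set K).

Lemma Rspan_in G g : G g -> Rspan iota G g.
Proof.
move=> Gg; exists 1%N, (fun=> 1), (fun=> g); split=> //.
by rewrite big_ord1 rmorph1 mul1r.
Qed.

Lemma Rspan0 G : Rspan iota G 0.
Proof.
exists 0%N, (fun=> 0), (fun=> 0); split; first by case.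
by rewrite big_ord0.
Qed.

Lemma RspanD G x y : Rspan iota G x -> Rspan iota G y -> Rspan iota G (x + y).
Proof.
move=> [n [c [g [gG ->]]]] [m [d [h [hG ->]]]].
exists (n + m)%N, (fun i => match split i with inl j => c j | inr j => d j end),
  (fun i => match split i with inl j => g j | inr j => h j end).
split=> [i|]; first by case: split.
rewrite big_split_ord /=; congr (_ + _); apply: eq_bigr => i _.
  by rewrite (unsplitK (inl i)).
by rewrite (unsplitK (inr i)).
Qed.

Lemma RspanZ G a x : Rspan iota G x -> Rspan iota G (iota a * x).
Proof.
move=> [n [c [g [gG ->]]]]; exists n, (fun i => a * c i), g; split=> //.
by rewrite mulr_sumr; apply: eq_bigr => i _; rewrite rmorphM mulrA.
Qed.

Lemma RspanN G x : Rspan iota G x -> Rspan iota G (- x).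
Proof. by move=> /(RspanZ (-1)); rewrite rmorphN1 mulN1r. Qed.

Lemma Rspan_sign G (b : nat) x : Rspan iota G ((-1) ^+ b * x) <-> Rspan iota G x.
Proof.
rewrite -signr_odd; case: odd; rewrite ?expr1 ?mulN1r ?expr0 ?mul1r //.
by split=> /RspanN; rewrite ?opprK.
Qed.

Lemma Rspan_sum G (I : Type) (r : seq I) (P : pred I) (F : I -> K) :
  (forall i, P i -> Rspan iota G (F i)) -> Rspan iota G (\sum_(i <- r | P i) F i).
Proof.
move=> H; elim/big_rec: _ => [|i x Pi]; first exact: Rspan0.
exact/RspanD/H.
Qed.

Lemma Rspan_min G H : (forall g, G g -> Rspan iota H g) ->
  forall x, Rspan iota G x -> Rspan iota H x.
Proof.
move=> GH x [n [c [g [gG ->]]]]; apply: Rspan_sum => i _.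
exact/RspanZ/GH.
Qed.

(** Used to replace one factor of a product by a generator while the other factor stays fixed. *)
Lemma Rspan_mulr G H k : (forall g, G g -> Rspan iota H (g * k)) ->
  forall x, Rspan iota G x -> Rspan iota H (x * k).
Proof.
move=> GH x [n [c [g [gG ->]]]]; rewrite mulr_suml; apply: Rspan_sum => i _.
rewrite -mulrA; exact/RspanZ/GH.
Qed.

Lemma OmegaM_in X Y x y : X x -> Y y -> OmegaM iota X Y (x * y).
Proof. by move=> Xx Yy; apply: Rspan_in; exists x => //; exists y. Qed.

Lemma Omega1E : Omega1 iota = Rspan iota [set 1].
Proof.
apply/seteqP; split=> [_ [r _ <-]|x].
  by rewrite -[iota r]mulr1; apply/RspanZ/Rspan_in.
move=> [n [c [g [gG ->]]]]; exists (\sum_i c i) => //.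
rewrite rmorph_sum; apply: eq_bigr => i _.
by have /= -> := gG i; rewrite mulr1.
Qed.

Lemma OmegaM_min X Y G : (forall x y, X x -> Y y -> Rspan iota G (x * y)) ->
  forall z, OmegaM iota X Y z -> Rspan iota G z.
Proof. by move=> H; apply: Rspan_min => _ [x Xx [y Yy <-]]; exact: H. Qed.

Lemma OmegaM_mulr X Y G k :
  (forall x y, X x -> Y y -> Rspan iota G (x * y * k)) ->
  forall z, OmegaM iota X Y z -> Rspan iota G (z * k).
Proof. by move=> H; apply: Rspan_mulr => _ [x Xx [y Yy <-]]; exact: H. Qed.

End Rspan.

(** * Spans of determinants *)

Section Delta.
Variables (R K : comPzRingType) (iota : {rmorphism R -> K}).

(** For a submodule [G] this is the image of its [m]-th exterior power in that of K^m, identified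
    with K by the determinant. *)
Definition delta m (G : set 'rV[K]_m) : set K :=
  Rspan iota [set d | exists A : 'M[K]_m, (forall i, G (row i A)) /\ d = \det A].

Lemma delta_det m (G : set 'rV[K]_m) (A : 'M[K]_m) :
  (forall i, G (row i A)) -> delta G (\det A).
Proof. by move=> GA; apply: Rspan_in; exists A. Qed.

(** Expanding along the first [l] columns, whose entries come from R, leaves an R-combination of
    maximal minors of [A]. The induction removes one such column at a time. *)
Lemma laplace_delta m l (G : set 'rV[K]_m) (B : 'M[R]_(l + m, l))
    (A : 'M[K]_(l + m, m)) :
  (forall i, G (row i A)) -> delta G (\det (row_mx (map_mx iota B) A)).
Proof.
elim: l B A => [|l IH] B A GA.
  suff -> : row_mx (map_mx iota B) A = A by exact: delta_det.
  apply/matrixP=> i j; rewrite mxE; case: splitP => [[]//|k jk].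
  by congr (A _ _); apply: val_inj.
rewrite (expand_det_col _ 0); apply: Rspan_sum => i _.
have -> : row_mx (map_mx iota B) A i 0 = iota (B i 0).
  transitivity (row_mx (map_mx iota B) A i (lshift m 0)).
    by congr (fun_of_matrix _ _ _); apply: val_inj.
  by rewrite row_mxEl mxE.
apply: RspanZ; apply/Rspan_sign.
have -> : row' i (col' 0 (row_mx (map_mx iota B) A)) =
  row_mx (map_mx iota (row' i (col' 0 B))) (row' i A).
  apply/matrixP => a b; rewrite !mxE.
  case: splitP => j /=; rewrite /bump leq0n add1n => jb; case: splitP => k /= kb.
  - by rewrite !mxE; congr (iota (B _ _)); apply: val_inj => /=; rewrite /bump leq0n -kb.
  - by have := ltn_ord j; rewrite -jb kb ltnS ltnNge leq_addr.
  - by have := ltn_ord k; rewrite -kb -ltnS jb ltnNge leq_addr.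
  - rewrite !mxE; congr (A _ _); apply: val_inj => /=; apply/eqP.
    by rewrite -(eqn_add2l l.+1) -jb addSn -kb.
apply: IH => j.
by have := GA (lift i j); congr G; apply/rowP => k; rewrite !mxE.
Qed.

End Delta.

(** * The Cauchy-Binet formula *)

Lemma det_mulmx_ffun (K : comPzRingType) k m (Y : 'M[K]_(m, k)) (X : 'M[K]_(k, m)) :
  \det (Y *m X) =
  \sum_(f : {ffun 'I_m -> 'I_k}) (\prod_i Y i (f i)) * \det (rowsub f X).
Proof.
pose AB s (f : {ffun 'I_m -> 'I_k}) i := Y i (f i) * X (f i) (s i).
transitivity (\sum_f \sum_(s : 'S_m) (-1) ^+ s * \prod_i AB s f i).
  rewrite exchange_big; apply: eq_bigr => /= s _; rewrite -big_distrr /=.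
  congr (_ * _); rewrite -(bigA_distr_bigA (fun i j => Y i j * X j (s i))) /=.
  by apply: eq_bigr => x _; rewrite mxE.
apply: eq_bigr => f _; rewrite /determinant mulr_sumr; apply: eq_bigr => s _.
rewrite big_split mulrCA /=; congr (_ * (_ * _)).
by apply: eq_bigr => i _; rewrite mxE.
Qed.

Lemma det_rowsub_ninj (K : comPzRingType) k m (f : 'I_m -> 'I_k) (X : 'M[K]_(k, m)) :
  ~ injective f -> \det (rowsub f X) = 0.
Proof.
move=> /injectiveP/injectivePn[i1 [i2 Di12 Ef12]].
by rewrite (determinant_alternate Di12) // => j; rewrite !mxE Ef12.
Qed.

(** The terms of [det_mulmx_ffun] are grouped by the image of [f]. Those with [f] not injective
    vanish; the injective ones with a given image are a fixed one composed with permutations, and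
    they sum to one product of minors. So [I] holds one enumeration of each subset of size [m]. *)
Lemma cauchy_binet (K : comPzRingType) k m (Y : 'M[K]_(m, k)) (X : 'M[K]_(k, m)) :
  exists I : seq {ffun 'I_m -> 'I_k},
    \det (Y *m X) = \sum_(f <- I) \det (colsub f Y) * \det (rowsub f X).
Proof.
pose im (f : {ffun 'I_m -> 'I_k}) := f @: [set: 'I_m]%SET.
pose T (f : {ffun 'I_m -> 'I_k}) := \det (colsub f Y) * \det (rowsub f X).
have H (A : {set 'I_k}) : exists I : seq {ffun 'I_m -> 'I_k},
    \sum_(f | im f == A) (\prod_i Y i (f i)) * \det (rowsub f X) = \sum_(f <- I) T f.
  have [[f0 [f0I f0A]]|nof] :=
    EM (exists f0 : {ffun 'I_m -> 'I_k}, injective f0 /\ im f0 = A); last first.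
    exists [::]; rewrite big_nil big1 // => f /eqP fA.
    by rewrite det_rowsub_ninj ?mulr0 // => fI; case: nof; exists f.
  exists [:: f0]; rewrite big_seq1 /T.
  rewrite [\det (colsub f0 Y)]/determinant mulr_suml.
  (* [u] and [v] are inverse bijections between the permutations and the functions with image [A];
     the default values in [v] are only taken for functions with another image. *)
  pose u (s : 'S_m) : {ffun 'I_m -> 'I_k} := [ffun i => f0 (s i)].
  pose v (f : {ffun 'I_m -> 'I_k}) : 'S_m := insubd (1%g : 'S_m)
    [ffun i => odflt i [pick j | f0 j == f i]].
  have uv f : im f == A -> u (v f) = f.
    move=> /eqP fA.
    have fI : injective f.
      apply/injectiveP; rewrite /injectiveb /dinjectiveb.
      have : #|im f| = #|'I_m| by rewrite fA -f0A /im card_imset ?cardsT.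
      by rewrite -cardsT => /eqP/imset_injP fI; apply/injectiveP => x y; apply: fI; rewrite inE.
    have P i : f0 (odflt i [pick j | f0 j == f i]) = f i.
      case: pickP => /= [j /eqP//|nj].
      have : f i \in im f by rewrite imset_f ?inE.
      by rewrite fA -f0A => /imsetP[j _ E]; have := nj j; rewrite E eqxx.
    have wI : injectiveb [ffun i => odflt i [pick j | f0 j == f i]].
      apply/injectiveP => i j; rewrite !ffunE => E; apply: fI.
      by rewrite -P E P.
    apply/ffunP => i; rewrite ffunE /v.
    have /ffunP/(_ i) := insubdK (1%g : 'S_m) wI.
    by rewrite ffunE => E; rewrite -[in RHS](P i) -E -pvalE.
  rewrite (reindex_onto u v uv); apply: eq_big => [s|s _].
    have imus : im (u s) == A.
      apply/eqP; rewrite -f0A; apply/setP => y.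
      apply/imsetP/imsetP => [[i _ ->]|[i _ ->]].
        by exists (s i); rewrite ?inE // ffunE.
      by exists ((s^-1)%g i); rewrite ?inE // ffunE permKV.
    rewrite imus; apply/eqP/permP => i; apply: f0I.
    by have /ffunP/(_ i) := uv _ imus; rewrite !ffunE.
  have -> : rowsub (u s) X = row_perm s (rowsub f0 X).
    by apply/matrixP => i j; rewrite !mxE ffunE.
  rewrite row_permE det_mulmx det_perm mulrA; congr (_ * _).
  by rewrite mulrC; congr (_ * _); apply: eq_bigr => i _; rewrite mxE ffunE.
have /boolp.choice[I IH] := H.
exists (flatten [seq I A | A <- enum {set 'I_k}]).
rewrite det_mulmx_ffun (partition_big im xpredT) //= big_flatten big_map big_enum /=.
by apply: eq_bigr => A _; rewrite IH.
Qed.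

(** * Fitting ideals *)

Section Fitting.
Variables (R : comPzRingType) (M : lmodType R).

Definition relations n (x : 'I_n -> M) : set 'rV[R]_n :=
  [set a | \sum_j a 0 j *: x j = 0].

Lemma minors_idealE n (x : 'I_n -> M) :
  minors_ideal x = delta idfun (relations x).
Proof.
congr (Rspan _ _); apply/seteqP; split=> _ [A [HA ->]]; exists A; split=> // i.
  by rewrite /relations /= -[RHS](HA i); apply: eq_bigr => j _; rewrite mxE.
by rewrite -[RHS](HA i); apply: eq_bigr => j _; rewrite mxE.
Qed.

Definition catf (T : Type) m n (y : 'I_m -> T) (x : 'I_n -> T) (i : 'I_(m + n)) : T :=
  match split i with inl j => y j | inr j => x j end.

Lemma catfl (T : Type) m n (y : 'I_m -> T) (x : 'I_n -> T) i :
  catf y x (lshift n i) = y i.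
Proof. by rewrite /catf (unsplitK (inl i)). Qed.

Lemma catfr (T : Type) m n (y : 'I_m -> T) (x : 'I_n -> T) i :
  catf y x (rshift m i) = x i.
Proof. by rewrite /catf (unsplitK (inr i)). Qed.

Lemma relations_cat m n (y : 'I_m -> M) (x : 'I_n -> M) a b :
  relations (catf y x) (row_mx a b) <->
  \sum_j a 0 j *: y j + \sum_j b 0 j *: x j = 0.
Proof.
rewrite /relations /= big_split_ord /=.
under eq_bigr do rewrite catfl row_mxEl.
by under [X in _ + X = _ <-> _]eq_bigr do rewrite catfr row_mxEr.
Qed.

(** If y = c x, then (a, b) is a relation of the larger family exactly when a c + b is one of [x]. A
    unimodular column operation thus makes the last [n] columns of a matrix of relations consist of
    relations of [x], and Laplace expansion applies. Conversely, adding the rows (1, -c) to a matrix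
    of relations of [x] keeps its determinant. *)
Lemma minors_ideal_cat m n (y : 'I_m -> M) (x : 'I_n -> M) :
  generates x -> minors_ideal (catf y x) = minors_ideal x.
Proof.
move=> gx; have /boolp.choice[c' yc'] : forall j, exists c : 'I_n -> R,
  y j = \sum_i c i *: x i by move=> j; exact: gx.
pose c : 'M[R]_(m, n) := \matrix_(i, j) c' i j.
have yc (a : 'rV[R]_m) : \sum_j a 0 j *: y j = \sum_j (a *m c) 0 j *: x j.
  under eq_bigr do rewrite yc' scaler_sumr.
  rewrite exchange_big; apply: eq_bigr => j _ /=.
  rewrite mxE scaler_suml; apply: eq_bigr => i _.
  by rewrite !mxE scalerA.
rewrite !minors_idealE; apply/seteqP; split; apply: Rspan_min => _ [A [HA ->]].
- have <- : \det (A *m block_mx 1%:M c 0 1%:M) = \det A.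
    by rewrite det_mulmx det_ublock !det1 !mulr1.
  rewrite -{1}[A]hsubmxK mul_row_block mulmx1 mulmx0 addr0 mulmx1.
  have <- : map_mx idfun (lsubmx A) = lsubmx A by apply/matrixP => i j; rewrite mxE.
  apply: (@laplace_delta R R idfun) => i; have := HA i.
  rewrite -[row i A]hsubmxK relations_cat yc -big_split /= => H.
  rewrite /relations /= -[RHS]H; apply: eq_bigr => j _.
  rewrite -scalerDl; congr (_ *: _); rewrite !mxE; congr (_ + _).
  by apply: eq_bigr => k _; rewrite !mxE.
- have <- : \det (block_mx 1%:M (- c) 0 A) = \det A.
    by rewrite det_ublock det1 mul1r.
  apply: delta_det => i; rewrite -[i]splitK; case: (split i) => j /=.
    rewrite rowKu row_row_mx relations_cat yc -big_split /= big1 // => k _.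
    by rewrite -scalerDl -row_mul mul1mx !mxE subrr scale0r.
  rewrite rowKd row_row_mx relations_cat yc big1 ?add0r; first exact: HA.
  by move=> k _; rewrite -row_mul mul0mx !mxE scale0r.
Qed.

Lemma minors_ideal_perm m n (h : 'I_m -> 'I_n) (x : 'I_n -> M) :
  bijective h -> minors_ideal (x \o h) = minors_ideal x.
Proof.
move=> hb; have e : m = n by have := bij_eq_card hb; rewrite !card_ord.
case: _ / e h hb x => h hb x; pose s := perm (bij_inj hb).
rewrite !minors_idealE; apply/seteqP; split; apply: Rspan_min => _ [A [HA ->]].
- have -> : A = col_perm s (col_perm s^-1 A).
    by apply/matrixP => i j; rewrite !mxE permK.
  rewrite col_permE det_mulmx det_perm mulrC; apply/Rspan_sign.
  apply: delta_det => i; have := HA i; rewrite /relations /= => H.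
  rewrite -[RHS]H (reindex_inj (@perm_inj _ s)) /=; apply: eq_bigr => j _.
  by rewrite !mxE permK permE.
- have -> : A = col_perm s^-1 (col_perm s A).
    by apply/matrixP => i j; rewrite !mxE permKV.
  rewrite col_permE det_mulmx det_perm mulrC; apply/Rspan_sign.
  apply: delta_det => i; have := HA i; rewrite /relations /= => H.
  rewrite -[RHS]H [RHS](reindex_inj (@perm_inj _ s)) /=; apply: eq_bigr => j _.
  by rewrite !mxE !permE.
Qed.

(** Each family is compared with a concatenation of both, and the two concatenations differ by a
    permutation. *)
Lemma minors_ideal_gen m n (y : 'I_m -> M) (x : 'I_n -> M) :
  generates x -> generates y -> minors_ideal x = minors_ideal y.
Proof.
move=> gx gy; rewrite -(minors_ideal_cat y gx) -(minors_ideal_cat x gy).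
pose h p q (i : 'I_(p + q)) : 'I_(q + p) :=
  match split i with inl j => rshift q j | inr j => lshift p j end.
have hK p q : cancel (@h p q) (@h q p).
  move=> i; rewrite -[i in RHS]splitK /h; case: (split i) => j /=.
    by rewrite (unsplitK (inr j)).
  by rewrite (unsplitK (inl j)).
rewrite -(@minors_ideal_perm _ _ (h m n)); last by exists (h n m).
congr (minors_ideal _); apply/funext => i /=.
rewrite -[i in LHS]splitK /h; case: (split i) => j /=.
  by rewrite catfl catfr.
by rewrite catfr catfl.
Qed.

Lemma FittE n (x : 'I_n -> M) : generates x -> Fitt M = minors_ideal x.
Proof.
move=> gx; apply: get_unique; first by exists n, x.
by move=> _ [m [y [gy ->]]]; apply: minors_ideal_gen.
Qed.

Lemma fracFittE (K : comPzRingType) (iota : {rmorphism R -> K}) n (x : 'I_n -> M) :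
  generates x ->
  fracFitt iota M = delta iota [set map_mx iota a | a in relations x].
Proof.
move=> gx; rewrite /fracFitt (FittE gx) minors_idealE; apply/seteqP; split.
  move=> _ [_ [p [c [g [gG ->]]]] <-]; rewrite rmorph_sum.
  apply: Rspan_sum => i _; rewrite rmorphM; apply: RspanZ.
  have [A [HA ->]] := gG i; rewrite -det_map_mx; apply: delta_det => j.
  by exists (row j A) => //; rewrite map_row.
move=> _ [p [c [g [gG ->]]]].
have /boolp.choice[g' gg'] : forall i, exists r, delta idfun (relations x) r /\ iota r = g i.
  move=> i; have [A [HA ->]] := gG i.
  have /boolp.choice[B HB] : forall j, exists b, relations x b /\ map_mx iota b = row j A.
    by move=> j; have [b Hb Eb] := HA j; exists b.
  exists (\det (\matrix_j B j)); split.
    by apply: delta_det => j; rewrite rowK; have [] := HB j.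
  rewrite -det_map_mx; congr (\det _); apply/row_matrixP => j.
  by rewrite -map_row rowK; have [] := HB j.
exists (\sum_i c i * g' i).
  apply: Rspan_sum => i _; apply: (@RspanZ R R idfun); by have [] := gg' i.
by rewrite rmorph_sum; apply: eq_bigr => i _; rewrite rmorphM; have [_ ->] := gg' i.
Qed.
End Fitting.

(** * Lattices in K^m and their duals *)

Section Lattice.
Variables (R K : comPzRingType) (iota : {rmorphism R -> K}).

Definition rspan k m (X : 'M[K]_(k, m)) : set 'rV[K]_m :=
  [set map_mx iota a *m X | a in setT].

Lemma rspan_rows p k m (X : 'M[K]_(k, m)) (A : 'M[K]_(p, m)) :
  (forall i, rspan X (row i A)) <->
  exists a : 'M[R]_(p, k), A = map_mx iota a *m X.
Proof.
split=> [HA|[a ->] i]; last first.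
  by exists (row i a) => //; rewrite row_mul map_row.
have /boolp.choice[c cA] : forall i, exists c, map_mx iota c *m X = row i A.
  by move=> i; have [c _ <-] := HA i; exists c.
exists (\matrix_i c i); apply/row_matrixP => i.
by rewrite row_mul -map_row rowK cA.
Qed.

Lemma rspan_rowsub p k m (X : 'M[K]_(k, m)) (f : 'I_p -> 'I_k) i :
  rspan X (row i (rowsub f X)).
Proof. by exists (delta_mx 0 (f i)) => //; rewrite map_delta_mx -rowE row_rowsub. Qed.

Lemma det_schur m n (A : 'M[K]_m) (B : 'M[K]_(m, n)) (C : 'M[K]_(n, m)) :
  \det (block_mx A B C 1%:M) = \det (A - B *m C).
Proof.
have -> : block_mx A B C 1%:M =
    block_mx 1%:M B 0 1%:M *m block_mx (A - B *m C) 0 C 1%:M.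
  by rewrite mulmx_block !mul1mx !mul0mx !mulmx1 !add0r subrK.
by rewrite det_mulmx det_ublock det_lblock !det1 !mul1r mulr1.
Qed.

(** By Cauchy-Binet, the finitely many maximal minors of [X] generate. *)
Lemma Omega_delta_rspan k m (X : 'M[K]_(k, m)) : Omega iota (delta iota (rspan X)).
Proof.
pose F := {ffun 'I_m -> 'I_k}.
exists #|F|, (fun i => \det (rowsub (enum_val i : F) X)).
apply/seteqP; split; last first.
  apply: Rspan_min => _ [i _ <-]; apply: delta_det => j; exact: rspan_rowsub.
apply: Rspan_min => _ [A [/rspan_rows[a ->] ->]].
have [I ->] := cauchy_binet (map_mx iota a) X.
apply: Rspan_sum => f _; rewrite -map_mxsub det_map_mx; apply/RspanZ/Rspan_in.
by exists (enum_rank f) => //; rewrite enum_rankK.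
Qed.

(* (X, Y) is a dual basis: the rows of X span a projective lattice, the columns
   of Y span the dual lattice, and E is the idempotent matrix it is cut out by. *)
Section Dual.
Variables (k m : nat) (X : 'M[K]_(k, m)) (Y : 'M[K]_(m, k)) (E : 'M[R]_k).
Hypotheses (YX : Y *m X = 1%:M) (XY : X *m Y = map_mx iota E).

(** The product of det(a X) and det(Y b^T) is det(a E b^T), which lies in R. Conversely,
    Cauchy-Binet expands 1 = det(Y X) into products of minors of [Y] and [X]. *)
Lemma delta_dual_mul :
  OmegaM iota (delta iota (rspan X)) (delta iota (rspan Y^T)) = Omega1 iota.
Proof.
rewrite Omega1E; apply/seteqP; split.
  apply: OmegaM_min => x y Hx Hy; rewrite mulrC; move: y Hy; apply: Rspan_mulr.
  move=> _ [B [/rspan_rows[b EB] ->]]; rewrite mulrC; move: x Hx; apply: Rspan_mulr.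
  move=> _ [A [/rspan_rows[a ->] ->]].
  rewrite -[\det B]det_tr EB trmx_mul trmxK -det_mulmx !mulmxA -(mulmxA _ X) XY.
  rewrite map_trmx -!map_mxM det_map_mx -[iota _]mulr1.
  exact/RspanZ/Rspan_in.
apply: Rspan_min => _ ->; rewrite -(det1 K m) -YX.
have [I ->] := cauchy_binet Y X; apply: Rspan_sum => f _.
rewrite mulrC; apply: OmegaM_in; last rewrite -det_tr.
  by apply: delta_det => i; exact: rspan_rowsub.
by rewrite trmx_mxsub; apply: delta_det => i; exact: rspan_rowsub.
Qed.

(** The product of the two spans contains 1, so [z] is a combination of the multiples x y z. *)
Lemma delta_dual_elim (G : set K) z :
  (forall x y, delta iota (rspan X) x -> delta iota (rspan Y^T) y ->
     Rspan iota G (x * y * z)) -> Rspan iota G z.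
Proof.
move=> H; rewrite -[z]mul1r.
have : OmegaM iota (delta iota (rspan X)) (delta iota (rspan Y^T)) 1.
  by rewrite delta_dual_mul; exists 1; rewrite ?rmorph1.
by move: 1; apply: OmegaM_mulr.
Qed.

(** The hypotheses identify [D] with the lattice [rspan X] modulo [G], the generators [z] being the
    classes of the rows of [X]. The right side is the index ideal of [G] in this lattice, its second
    factor being the inverse of the delta of [rspan X]. *)
Lemma fracFitt_quot (D : lmodType R) (z : 'I_k -> D) (G : set 'rV[K]_m) :
  generates z -> G 0 -> (forall v, G v -> rspan X v) ->
  (forall a, relations z a <-> G (map_mx iota a *m X)) ->
  fracFitt iota D = OmegaM iota (delta iota G) (delta iota (rspan Y^T)).
Proof.
move=> gz G0 GX Gz; apply/seteqP; split.
  rewrite (fracFittE iota gz); apply: Rspan_min => _ [T [HT ->]].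
  have TG i : G (row i (T *m X)).
    by have [a /Gz + aT] := HT i; rewrite aT -row_mul.
  have [t tT] : exists t : 'M[R]_k, T = map_mx iota t.
    have /boolp.choice[t Ht] : forall i, exists a, map_mx iota a = row i T.
      by move=> i; have [a _ <-] := HT i; exists a.
    by exists (\matrix_i t i); apply/row_matrixP => i; rewrite -map_row rowK Ht.
  apply: delta_dual_elim => x y Hx Hy.
  rewrite mulrC mulrA; apply: OmegaM_in => //.
  rewrite mulrC; move: x Hx; apply: Rspan_mulr => _ [A [/rspan_rows[a ->] ->]].
  (* The first [k] columns of the block matrix are integral and the last [m] columns have rows in
     [G], the lower ones being 0; Laplace expansion then puts its determinant in the delta of
     [G]. *)
  have -> : \det (map_mx iota a *m X) * \det T =
     (-1) ^+ m * \det (block_mx T (T *m X) (map_mx iota a) 0).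
    have -> : block_mx T (T *m X) (map_mx iota a) 0 =
      block_mx T 0 (map_mx iota a) (- (map_mx iota a *m X)) *m block_mx 1%:M X 0 1%:M.
      by rewrite mulmx_block !mulmx1 !mulmx0 !addr0 subrr.
    rewrite det_mulmx det_ublock det_lblock !det1 !mulr1 -scaleN1r detZ.
    by rewrite mulrCA (mulrA ((-1)^+m)) -signr_odd -expr2 sqrr_sign mul1r mulrC.
  apply/Rspan_sign; rewrite block_mxEh {1}tT -map_col_mx.
  apply: laplace_delta => i; rewrite -[i]splitK; case: (split i) => j /=.
    by rewrite rowKu; apply: TG.
  by rewrite rowKd row0.
(* The m added zero generators make room for the matrix T below, which is
   [diag(1, A) U diag(1, B^T)] for the involution [U] with blocks
   [1 - X Y, X; Y, 0]. *)
have gz0 : generates (@catf D k m z (fun=> 0)).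
  move=> d; have [c ->] := gz d; exists (catf c (fun=> 0)).
  rewrite big_split_ord /= [X in _ + X]big1 => [|i _]; last by rewrite !catfr scaler0.
  by rewrite addr0; apply: eq_bigr => i _; rewrite !catfl.
rewrite (fracFittE iota gz0); apply: OmegaM_min => x y Hx Hy; rewrite mulrC.
move: y Hy; apply: Rspan_mulr.
move=> _ [B [/rspan_rows[b EB] ->]]; rewrite mulrC; move: x Hx; apply: Rspan_mulr.
move=> _ [A [GA ->]].
have [a Ea] : exists a : 'M[R]_(m, k), A = map_mx iota a *m X.
  by apply/rspan_rows => i; apply: GX.
pose T := block_mx (1%:M - E) (E *m b^T) (a *m E) (0 : 'M_m).
have dU : \det (block_mx (1%:M - X *m Y) X Y 0) = (-1) ^+ m.
  have dW : \det (block_mx 1%:M X Y 0) = (-1) ^+ m.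
    have -> : block_mx 1%:M X Y 0 = block_mx 1%:M 0 Y (- 1%:M) *m block_mx 1%:M X 0 1%:M.
      by rewrite mulmx_block !mulmx1 !mulmx0 !addr0 mul1mx YX subrr.
    by rewrite det_mulmx det_ublock det_lblock !det1 !mulr1 mul1r -scaleN1r detZ det1 mulr1.
  rewrite -dW; have -> : block_mx 1%:M X Y 0 =
      block_mx (1%:M - X *m Y) X Y 0 *m block_mx 1%:M 0 Y 1%:M.
    by rewrite mulmx_block !mulmx1 !mulmx0 mul0mx addr0 !add0r subrK.
  by rewrite det_mulmx det_lblock !det1 !mulr1.
have -> : \det A * \det B = (-1) ^+ m * \det (map_mx iota T).
  have -> : map_mx iota T = block_mx 1%:M 0 0 A *m
      block_mx (1%:M - X *m Y) X Y 0 *m block_mx 1%:M 0 0 B^T.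
    rewrite map_block_mx !mulmx_block !mul1mx !mulmx1 !mulmx0 !mul0mx !addr0 !add0r.
    rewrite EB Ea trmx_mul trmxK map_trmx !map_mxM map_mxB map_mx1 map_mx0 -XY.
    by rewrite !mulmxA !mul0mx.
  rewrite !det_mulmx det_ublock det_lblock !det1 !mul1r det_tr dU.
  by rewrite mulrAC mulrCA -expr2 -signr_odd sqrr_sign mulr1.
apply/Rspan_sign; apply: delta_det => i.
exists (row i T); last by rewrite map_row.
have rcat c d : relations z c -> relations (@catf D k m z (fun=> 0)) (row_mx c d).
  move=> H; apply/relations_cat; rewrite [X in _ + X]big1 ?addr0 // => j _.
  by rewrite scaler0.
(* Since Y X = 1, right multiplication by [X] turns the upper left block of [T] into 0 and the lower
   left one into [A]; hence all rows of [T] are relations. *)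
rewrite -[i]splitK; case: (split i) => j /=; rewrite (rowKu, rowKd) row_row_mx.
  apply/rcat/Gz; rewrite map_row map_mxB map_mx1 -XY -row_mul mulmxBl mul1mx.
  by rewrite -mulmxA YX mulmx1 subrr row0.
apply/rcat/Gz; rewrite map_row map_mxM -XY -row_mul -!mulmxA YX mulmx1 -Ea.
exact: GA.
Qed.

Variables (p : nat) (C : 'M[R]_(p, m)).

Let N := rspan (col_mx X (map_mx iota C)).
Let G := rspan (col_mx 1%:M (Y^T *m (map_mx iota C)^T)).

(** Let L be the lattice spanned by [X] and L^v its dual: [N] is L + R^p C and [G] is R^p + L^v C^T.
    For [W] with rows in [N] and [H] with rows in L^v, H W^T is an integral matrix plus H C^T B^T.
    This is a Schur complement in a block matrix whose first [m] columns are integral and whose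
    other columns have rows in [G]. *)
Lemma delta_coker_dual x y :
  delta iota N x -> delta iota (rspan Y^T) y -> delta iota G (x * y).
Proof.
move=> Hx Hy; move: x Hx; apply: Rspan_mulr => _ [W [/rspan_rows[a EW] ->]].
rewrite mulrC; move: y Hy; apply: Rspan_mulr => _ [H [/rspan_rows[b EH] ->]].
move: EW; rewrite -[a]hsubmxK map_row_mx mul_row_col => EW.
set A := lsubmx a in EW; set B := rsubmx a in EW.
have -> : \det H * \det W = \det (block_mx (map_mx iota (A *m E *m b^T)^T)
    (H *m (map_mx iota C)^T) (map_mx iota (- B^T)) 1%:M).
  rewrite det_schur -det_tr mulrC -det_mulmx -[RHS]det_tr; congr (\det _).
  rewrite EW EH mulmxDl map_mxN mulmxN opprK linearD /= -!map_trmx !trmx_mul !trmxK.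
  by rewrite !map_mxM -XY map_trmx !mulmxA.
rewrite block_mxEh -map_col_mx; apply: laplace_delta => i.
rewrite -[i]splitK; case: (split i) => j /=; rewrite (rowKu, rowKd).
  exists (row_mx 0 (row j b)) => //.
  rewrite map_row_mx mul_row_col map_mx0 mul0mx add0r map_row EH -!row_mul.
  by rewrite !mulmxA.
by exists (row_mx (row j 1%:M) 0) => //;
  rewrite map_row_mx mul_row_col map_mx0 mul0mx addr0 mulmx1 map_row map_mx1.
Qed.

(** The mirror image of [delta_coker_dual]: for [H] with rows in L, H Y is integral. So the first
    [p] columns of the block matrix are integral, while the others have rows in [N]. *)
Lemma delta_dual_coker x y :
  delta iota G x -> delta iota (rspan X) y -> delta iota N (x * y).
Proof.
move=> Hx Hy; move: x Hx; apply: Rspan_mulr => _ [W [/rspan_rows[a EW] ->]].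
rewrite mulrC; move: y Hy; apply: Rspan_mulr => _ [H [/rspan_rows[c EH] ->]].
move: EW; rewrite -[a]hsubmxK map_row_mx mul_row_col mulmx1 => EW.
set A := lsubmx a in EW; set B := rsubmx a in EW.
have -> : \det H * \det W = \det (block_mx (map_mx iota A^T)
    (map_mx iota C) (map_mx iota (- (c *m E *m B^T))) H).
  have -> : block_mx (map_mx iota A^T) (map_mx iota C)
      (map_mx iota (- (c *m E *m B^T))) H = block_mx 1%:M 0 0 H *m
      block_mx (map_mx iota A^T) (map_mx iota C) (- (Y *m (map_mx iota B)^T)) 1%:M.
    rewrite mulmx_block !mul1mx !mul0mx mulmx1 !addr0 !add0r mulmxN mulmxA.
    by rewrite map_mxN !map_mxM -XY EH !map_trmx !mulmxA.
  rewrite det_mulmx det_ublock det1 mul1r det_schur; congr (_ * _).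
  rewrite -det_tr EW linearD /= mulmxN opprK !trmx_mul !trmxK map_trmx.
  by rewrite mulmxA.
rewrite block_mxEh -map_col_mx; apply: laplace_delta => i.
rewrite -[i]splitK; case: (split i) => j /=; rewrite (rowKu, rowKd).
  by exists (row_mx 0 (row j 1%:M)) => //;
    rewrite map_row_mx mul_row_col map_mx0 mul0mx add0r map_row map_mx1 -row_mul mul1mx.
exists (row_mx (row j c) 0) => //.
by rewrite map_row_mx mul_row_col map_mx0 mul0mx addr0 map_row EH -row_mul.
Qed.
End Dual.
End Lattice.

(** * Resolutions and stable retracts *)

Section Modules.
Variable R : comPzRingType.
Implicit Types A B M N Q T V W Z : lmodType R.

Lemma linear_ex A B (f : A -> B) : linear f -> exists g : {linear A -> B}, g =1 f.
Proof.
move=> lf; pose L := GRing.isLinear.Build R A B *:%R f lf.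
by pose g : {linear A -> B} := HB.pack f L; exists g.
Qed.

Lemma factor_inj A Q Z (i : {linear A -> Q}) (f : {linear Z -> Q}) :
  injective i -> (forall z, exists a, i a = f z) ->
  exists g : {linear Z -> A}, forall z, i (g z) = f z.
Proof.
move=> iI /boolp.choice[g0 g0E].
have [|g gE] := @linear_ex Z A g0; last by exists g => z; rewrite gE.
by move=> a x y; apply: iI; rewrite linearP !g0E linearP.
Qed.

Lemma factor_surj W B T (p : {linear W -> B}) (f : {linear W -> T}) :
  surjective p -> (forall w, p w = 0 -> f w = 0) ->
  exists g : {linear B -> T}, forall w, g (p w) = f w.
Proof.
move=> ps pf; have /boolp.choice[s sE] := ps.
have fs w : f (s (p w)) = f w.
  by apply: subr0_eq; rewrite -linearB; apply: pf; rewrite linearB sE subrr.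
have [|g gE] := @linear_ex B T (f \o s); last by exists g => w; rewrite gE /= fs.
move=> a x y /=; have [[u <-] [v <-]] := (ps x, ps y).
by rewrite -linearP !fs linearP.
Qed.

Lemma projective_rV n : projective 'rV[R]_n.
Proof.
move=> A B g f gs.
have /boolp.choice[a aE] : forall i, exists x, g x = f (delta_mx 0 i).
  by move=> i; exact: gs.
have [|h hE] := @linear_ex 'rV[R]_n A (fun v => \sum_i v 0 i *: a i).
  move=> c u v; rewrite scaler_sumr -big_split /=; apply: eq_bigr => i _.
  by rewrite !mxE scalerDl scalerA.
exists h => x; rewrite hE [x in RHS]row_sum_delta !linear_sum.
by apply: eq_bigr => i _; rewrite !linearZ_LR aE.
Qed.

Lemma rV_linear n A (a : 'I_n -> A) :
  exists f : {linear 'rV[R]_n -> A}, forall v, f v = \sum_i v 0 i *: a i.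
Proof.
apply: linear_ex => c u v; rewrite scaler_sumr -big_split /=; apply: eq_bigr => i _.
by rewrite !mxE scalerDl scalerA.
Qed.

Lemma rV_linearE n A (f : {linear 'rV[R]_n -> A}) v :
  f v = \sum_i v 0 i *: f (delta_mx 0 i).
Proof.
by rewrite [v in LHS]row_sum_delta linear_sum; apply: eq_bigr => i _; rewrite linearZ_LR.
Qed.

Lemma rV_linear_mx n k (f : {linear 'rV[R]_n -> 'rV[R]_k}) v :
  f v = v *m \matrix_i f (delta_mx 0 i).
Proof.
rewrite rV_linearE; apply/rowP => j; rewrite summxE mxE.
by apply: eq_bigr => i _; rewrite !mxE.
Qed.

Definition ses A Q B (i : {linear A -> Q}) (p : {linear Q -> B}) :=
  [/\ injective i, exact_at i p, surjective p & projective Q].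

(* A is a direct summand of B + Q with Q projective.  This relation passes to
   syzygies, so that Ext can be read off from any projective resolution. *)
Definition stable_retract A B :=
  exists (f : {linear A -> B}) (g : {linear B -> A}) (Q : lmodType R)
    (r : {linear A -> Q}) (s : {linear Q -> A}),
    projective Q /\ forall x, x = g (f x) + s (r x).

Lemma iso_stable_retract A B (f : {linear A -> B}) (g : {linear B -> A}) :
  cancel f g -> stable_retract A B.
Proof.
move=> fK; exists f, g, 'rV[R]_0, \0, \0; split; first exact: projective_rV.
by move=> x; rewrite fK addr0.
Qed.

Lemma stable_retract_refl A : stable_retract A A.
Proof. exact: (@iso_stable_retract A A idfun idfun). Qed.

(** By projectivity [f], [g] and [s] lift to [a], [b] and [t]. The map 1 - b a - t r p lands in the
    kernel of [p], which gives [c]; on A its last term vanishes because p i = 0. *)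
Lemma stable_retract_lift A Q B A' Q' B' (i : {linear A -> Q})
    (p : {linear Q -> B}) (i' : {linear A' -> Q'}) (p' : {linear Q' -> B'}) :
  ses i p -> ses i' p' -> stable_retract B B' ->
  exists (a : {linear Q -> Q'}) (a1 : {linear A -> A'}) (b1 : {linear A' -> A})
    (c : {linear Q -> A}),
    (forall x, i' (a1 x) = a (i x)) /\ (forall x, x = b1 (a1 x) + c (i x)).
Proof.
move=> [iI ip ps Qp] [i'I ip' ps' Qp'] [f [g [P [r [s [Pp E]]]]]].
have [a aE] := Qp _ _ p' (f \o p) ps'.
have [b bE] := Qp' _ _ p (g \o p') ps.
have [t tE] := Pp _ _ p s ps.
have p0 x : p (i x) = 0 by apply/ip; exists x.
have p'0 x : p' (i' x) = 0 by apply/ip'; exists x.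
have [z|a1 a1E] := @factor_inj _ _ _ i' (a \o i) i'I.
  by apply/ip'; rewrite /= aE /= p0 linear0.
have [z|b1 b1E] := @factor_inj _ _ _ i (b \o i') iI.
  by apply/ip; rewrite /= bE /= p'0 linear0.
have [z|c cE] := @factor_inj _ _ _ i ((idfun \- (b \o a)) \- (t \o (r \o p))) iI.
  apply/ip; rewrite /= !linearB /= bE /= aE tE /= -addrA -opprD -E.
  by rewrite subrr.
exists a, a1, b1, c; split=> [//|x]; apply: iI.
by rewrite linearD b1E /= a1E cE /= p0 (linear0 r) (linear0 t) subr0 addrC subrK.
Qed.

Lemma stable_retract_ses A Q B A' Q' B' (i : {linear A -> Q}) (p : {linear Q -> B})
    (i' : {linear A' -> Q'}) (p' : {linear Q' -> B'}) :
  ses i p -> ses i' p' -> stable_retract B B' -> stable_retract A A'.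
Proof.
move=> si si' BB'; have [a [a1 [b1 [c [_ E]]]]] := stable_retract_lift si si' BB'.
by exists a1, b1, Q, i, c; split=> //; have [] := si.
Qed.

(** When [i] begins a short exact sequence with projective middle term and cokernel B, this says
    that Ext^1(B, R) = 0. *)
Definition extends A Q (i : {linear A -> Q}) :=
  forall xi : {linear A -> R^o}, exists psi : {linear Q -> R^o},
    forall a, psi (i a) = xi a.

Lemma stable_retract_extends A Q B A' Q' B' (i : {linear A -> Q})
    (p : {linear Q -> B}) (i' : {linear A' -> Q'}) (p' : {linear Q' -> B'}) :
  ses i p -> ses i' p' -> stable_retract B B' -> extends i' -> extends i.
Proof.
move=> si si' BB' ei' xi.
have [a [a1 [b1 [c [a1E E]]]]] := stable_retract_lift si si' BB'.
have [psi psiE] := ei' (xi \o b1).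
exists ((psi \o a) \+ (xi \o c)) => x /=.
by rewrite -a1E psiE /= -linearD -E.
Qed.

Lemma kernel_ses Q B (p : {linear Q -> B}) :
  projective Q -> surjective p ->
  ses (val : subm (kernel p) -> Q) p.
Proof.
move=> PQ ps; split=> //; first exact: val_inj.
move=> b; split=> [b0|[x <-]]; last exact/asboolP/(valP x).
have kb : b \in kernel p by exact/asboolP.
by exists (in_subm kb).
Qed.

Definition syz_incl B t : {linear syzygy B t.+1 -> free_mod R (syzygy B t)} :=
  (val : subm (kernel (free_cover (syzygy B t))) -> _).

Lemma syz_ses B t : ses (syz_incl B t) (free_cover (syzygy B t)).
Proof. exact: kernel_ses (@free_projective R _) (@free_cover_surj R _). Qed.

Lemma cocycle_syzygy B t (xi : {linear syzygy B t.+1 -> R^o}) :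
  (xi \o free_cover (syzygy B t.+1) : _ -> R^o) \in cocycle R^o (free_res B) t.+1.
Proof.
apply/asboolP; split=> [|x]; first exact: linearP.
rewrite /= (_ : free_cover _ _ = 0) ?linear0 //.
exact/asboolP/(valP (free_cover (syzygy B t.+2) x)).
Qed.

Lemma cocycle_factor B t (u : subm (cocycle R^o (free_res B) t.+1)) :
  exists xi : {linear syzygy B t.+1 -> R^o},
    forall y, xi (free_cover (syzygy B t.+1) y) = val u y.
Proof.
have /asboolP [lu du] := valP u.
have [f0 f0E] := linear_ex lu.
have [w w0|xi xiE] := @factor_surj _ _ _ (free_cover (syzygy B t.+1)) f0 (@free_cover_surj _ _).
  have [_ /(_ w)[+ _] _ _] := syz_ses B t.+1.
  by move=> /(_ w0)[y <-]; rewrite f0E -(du (free_basis R y)) /= /syzygy_d /= free_eval_basis.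
by exists xi => y; rewrite xiE f0E.
Qed.

(** Cocycles of degree t+1 are the functionals on the syzygy of index t+1, and the coboundaries are
    those that extend to the free module containing it. *)
Lemma Ext0P B t : zero_mod (Ext B R^o t.+1) <-> extends (syz_incl B t).
Proof.
split=> [H xi|H].
  have fc := cocycle_syzygy xi.
  have /projm_eq : projm
      (Submod (@coboundary_cocycle_closed _ _ _ (free_res B) t.+1))
      (in_subm fc) = projm _ 0 by rewrite [LHS]H linear0.
  rewrite subr0 => /asboolP [g fg]; exists g => a.
  have [x <-] := free_cover_surj a.
  by move/(congr1 (fun h => h x)): fg.
move=> x; have [u ->] := projm_surj x.
rewrite -[RHS](linear0 (projm _)); apply/projm_eq; rewrite subr0.
have [xi xiE] := cocycle_factor u; have [psi psiE] := H xi.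
apply/asboolP; exists psi; apply/funext => y.
by rewrite -xiE -psiE.
Qed.

Lemma stable_retract_Ext0 B B' t : stable_retract B B' ->
  zero_mod (Ext B' R^o t.+1) -> zero_mod (Ext B R^o t.+1).
Proof.
move=> H /Ext0P H'; apply/Ext0P; apply: stable_retract_extends (H'); try exact: syz_ses.
by elim: {H'} t => [|t IH] //; apply: stable_retract_ses IH; apply: syz_ses.
Qed.


Lemma fg_cover M : fg_mod M ->
  exists n (x : 'I_n -> M) (p : {linear 'rV[R]_n -> M}),
    [/\ generates x, forall v, p v = \sum_i v 0 i *: x i & surjective p].
Proof.
move=> [n [x gx]]; have [p pE] := rV_linear x; exists n, x, p; split=> // m.
have [c ->] := gx m; exists (\row_i c i); rewrite pE.
by apply: eq_bigr => i _; rewrite mxE.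
Qed.

Lemma surj_fg M N (p : {linear M -> N}) : surjective p -> fg_mod M -> fg_mod N.
Proof.
move=> ps [n [x gx]]; exists n, (p \o x) => y.
have [m <-] := ps y; have [c ->] := gx m; exists c.
by rewrite linear_sum; apply: eq_bigr => i _; rewrite linearZ_LR.
Qed.

(** Induction on [n]: the first coordinates of the vectors of [W] form an ideal, and the vectors of
    [W] starting with 0 form a submodule of a free module of smaller rank. *)
Lemma noetherian_rV n (W : submod 'rV[R]_n) : noetherian R ->
  exists k (X : 'M[R]_(k, n)), forall v, v \in W <-> exists a, v = a *m X.
Proof.
move=> nR; elim: n W => [|n IH] W.
  exists 0%N, 0 => v; split=> _; first by exists 0; apply/rowP; case.
  by rewrite (_ : v = 0) ?rpred0 //; apply/rowP; case.
rewrite -[n.+1]/(1 + n)%N in W *; pose o := lshift n (0 : 'I_1).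
have Icl : submod_closed [pred r : R^o | `[< exists2 v, v \in W & v 0 o = r >]].
  split=> [|c r s]; first by apply/asboolP; exists 0; rewrite ?rpred0 ?mxE.
  move=> /asboolP[u uW <-] /asboolP[v vW <-]; apply/asboolP.
  by exists (c *: u + v); rewrite ?rpredD ?rpredZ // !mxE.
have Jcl : submod_closed [pred v : 'rV[R]_n | row_mx (0 : 'rV_1) v \in W].
  split=> [|c u v]; rewrite !inE ?row_mx0 ?rpred0 // => uW vW.
  rewrite (_ : row_mx _ _ = c *: row_mx 0 u + row_mx 0 v) ?rpredD ?rpredZ //.
  by rewrite scale_row_mx add_row_mx scaler0 addr0.
have [p [c gc]] := nR (Submod Icl).
have [q [X XE]] := IH (Submod Jcl).
have /boolp.choice[w wE] : forall i, exists w, w \in W /\ w 0 o = val (c i).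
  by move=> i; have /asboolP[w wW ww] := valP (c i); exists w.
have wW i : w i \in W by have [] := wE i.
pose Z : 'M[R]_(p, 1 + n) := \matrix_i w i.
have ZW b : b *m Z \in W.
  by rewrite mulmx_sum_row rpred_sum // => i _; rewrite rpredZ // rowK.
pose XX : 'M[R]_(q, 1 + n) := row_mx (0 : 'M_(q, 1)) X.
have XW a : a *m XX \in W.
  by rewrite mul_mx_row mulmx0; have /XE : exists b, a *m X = b *m X by exists a.
exists (p + q)%N, (col_mx Z XX) => v; split=> [vW|[a ->]]; last first.
  by rewrite -[a]hsubmxK mul_row_col rpredD.
have Iv : (v 0 o : R^o) \in Submod Icl by apply/asboolP; exists v.
have [b bE] := gc (in_subm Iv).
pose u := v - \row_i b i *m Z.
have u0 : u 0 o = 0.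
  rewrite !mxE; have := congr1 val bE; rewrite linear_sum /= => ->.
  rewrite -sumrB big1 // => i _; rewrite !mxE /=.
  by have [_ ->] := wE i; rewrite subrr.
have uE : u = row_mx (0 : 'rV_1) (rsubmx u).
  rewrite -[LHS](hsubmxK u); congr row_mx.
  by apply/rowP => i; rewrite !mxE -[RHS]u0 (ord1 i) /u !mxE.
have : rsubmx u \in Submod Jcl.
  by rewrite inE /= -uE rpredB.
move=> /XE[a aE]; exists (row_mx (\row_i b i) a).
by rewrite mul_row_col mul_mx_row mulmx0 -aE -uE addrC subrK.
Qed.

Lemma noetherian_kernel n A (f : {linear 'rV[R]_n -> A}) : noetherian R ->
  exists k (X : 'M[R]_(k, n)), forall v, f v = 0 <-> exists a, v = a *m X.
Proof.
move=> /(noetherian_rV (kernel f))[k [X XE]]; exists k, X => v; rewrite -XE.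
by split=> /asboolP.
Qed.

Definition row_span k n (X : 'M[R]_(k, n)) : submod 'rV[R]_n :=
  image_mod (mulmxr X : {linear 'rV[R]_k -> 'rV[R]_n}).

Lemma row_spanP k n (X : 'M[R]_(k, n)) v :
  reflect (exists a, a *m X = v) (v \in row_span X).
Proof. exact: asboolP. Qed.

Lemma row_span_cover k n (X : 'M[R]_(k, n)) :
  exists p : {linear 'rV[R]_k -> subm (row_span X)},
    (forall v, val (p v) = v *m X) /\ surjective p.
Proof.
have [z|p pE] := @factor_inj _ _ _ (val : subm (row_span X) -> 'rV[R]_n)
  (mulmxr X : {linear 'rV[R]_k -> 'rV[R]_n}) val_inj.
  have zX : z *m X \in row_span X by apply/row_spanP; exists z.
  by exists (in_subm zX).
exists p; split=> // y; have /row_spanP[a aE] := valP y.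
by exists a; apply: val_inj; rewrite pE.
Qed.

Lemma row_span_ses k n l (X : 'M[R]_(k, n)) (Z : 'M[R]_(l, k)) :
  (forall v : 'rV_k, v *m X = 0 <-> exists a, v = a *m Z) ->
  exists p : {linear 'rV[R]_k -> subm (row_span X)},
    ses (val : subm (row_span Z) -> 'rV[R]_k) p.
Proof.
move=> ker; have [p [pE ps]] := row_span_cover X; exists p; split=> //.
- exact: val_inj.
- move=> v; split=> [pv|[x <-]].
    have /ker[a av] : v *m X = 0 by rewrite -pE pv raddf0.
    have vZ : v \in row_span Z by apply/row_spanP; exists a.
    by exists (in_subm vZ).
  apply: val_inj; rewrite pE raddf0; apply/ker.
  by have /row_spanP[a aE] := valP x; exists a; exact: esym aE.
- exact: projective_rV.
Qed.

End Modules.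

(** * Embedding into a module of projective dimension at most 1 *)

Section Embedding.
Variable R : comPzRingType.
Implicit Types A B M N Q T V W Z : lmodType R.

Lemma projective_prod P Q : projective P -> projective Q -> projective (P * Q)%type.
Proof.
move=> PP PQ A B g f gs.
have [|f1 f1E] := @linear_ex R P B (fun x => f (x, 0)).
  by move=> a x y; rewrite -linearP; congr (f (_, _)); rewrite /= scaler0 addr0.
have [|f2 f2E] := @linear_ex R Q B (fun y => f (0, y)).
  by move=> a x y; rewrite -linearP; congr (f (_, _)); rewrite /= scaler0 addr0.
have [h1 h1E] := PP _ _ g f1 gs; have [h2 h2E] := PQ _ _ g f2 gs.
exists ((h1 \o fst) \+ (h2 \o snd)) => -[x y] /=.
rewrite linearD h1E h2E f1E f2E -linearD; congr (f (_, _)) => /=.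
  by rewrite addr0.
by rewrite add0r.
Qed.

Lemma stable_retract_trans A B C : stable_retract A B -> stable_retract B C ->
  stable_retract A C.
Proof.
move=> [f [g [P [r [s [PP E]]]]]] [f' [g' [P' [r' [s' [PP' E']]]]]].
have [|rr rrE] := @linear_ex R A (P * P')%type (fun x => (r x, r' (f x))).
  by move=> a x y; rewrite !linearP.
exists (f' \o f), (g \o g'), (P * P')%type, rr, ((s \o fst) \+ ((g \o s') \o snd)).
split=> [|x]; first exact: projective_prod.
by rewrite /= rrE /= [LHS]E [in LHS](E' (f x)) linearD -addrA [_ + s _]addrC.
Qed.

Lemma quot_ses n (W : submod 'rV[R]_n) :
  ses (val : subm W -> 'rV[R]_n) (@projm R 'rV[R]_n W).
Proof.
split; [exact: val_inj| | |exact: projective_rV]; last first.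
  by move=> x; have [v ->] := projm_surj x; exists v.
move=> v; rewrite -(linear0 (projm W)) projm_eq subr0.
split=> [vW|[x <-]]; first by exists (in_subm vW).
exact: valP x.
Qed.

Lemma matrix_resolution M : noetherian R -> fg_mod M ->
  exists (n : nat -> nat) (D : forall i, 'M[R]_(n i.+1, n i))
    (p : {linear 'rV[R]_(n 0%N) -> M}),
  [/\ surjective p, forall v, p v = 0 <-> exists a, v = a *m D 0%N
    & forall i (v : 'rV_(n i.+1)), v *m D i = 0 <-> exists a, v = a *m D i.+1].
Proof.
move=> nR /fg_cover[n0 [_ [p [_ _ ps]]]].
have [n1 [D0 D0E]] := noetherian_kernel p nR.
(* The sizes of the matrices vary along the resolution, so the recursion runs over matrices bundled
   with their dimensions. *)
pose state := {b : nat & {a : nat & 'M[R]_(a, b)}}.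
pose mx (s : state) := tagged (tagged s).
have H (s : state) : exists t : {a : nat & 'M[R]_(a, tag (tagged s))},
    forall v : 'rV_(tag (tagged s)), v *m mx s = 0 <-> exists a, v = a *m tagged t.
  have [k [X XE]] := noetherian_kernel
    (mulmxr (mx s) : {linear 'rV_(tag (tagged s)) -> 'rV_(tag s)}) nR.
  by exists (Tagged (fun a => 'M[R]_(a, _)) X).
pose next s := projT1 (cid (H s)); have nextE s := projT2 (cid (H s)).
pose step (s : state) : state :=
  Tagged (fun b => {a : nat & 'M[R]_(a, b)}) (next s).
pose s0 : state := Tagged (fun b => {a : nat & 'M[R]_(a, b)})
  (Tagged (fun a => 'M[R]_(a, n0)) D0).
pose s i := iter i step s0.
exists (fun i => tag (s i)), (fun i => mx (s i)), p.
split=> // i v; exact: nextE.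
Qed.

(** * The dual of a free resolution *)

Section Dual.
Variables (M : lmodType R) (n : nat -> nat) (D : forall i, 'M[R]_(n i.+1, n i)).
Variable p : {linear 'rV[R]_(n 0%N) -> M}.
Hypotheses (ps : surjective p)
  (pD : forall v, p v = 0 <-> exists a, v = a *m D 0%N)
  (DD : forall i (v : 'rV_(n i.+1)), v *m D i = 0 <-> exists a, v = a *m D i.+1).

Lemma resolution_mul0 i : D i.+1 *m D i = 0.
Proof.
apply/row_matrixP => j; rewrite row0 row_mul; apply/DD.
by exists (delta_mx 0 j); rewrite -rowE.
Qed.

Lemma resolution_ses0 : ses (val : subm (row_span (D 0%N)) -> 'rV[R]_(n 0%N)) p.
Proof.
split=> //; [exact: val_inj| |exact: projective_rV].
move=> v; rewrite pD; split=> [[a av]|[x <-]].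
  have vD : v \in row_span (D 0%N) by apply/row_spanP; exists a.
  by exists (in_subm vD).
by have /row_spanP[a aE] := valP x; exists a; exact: esym aE.
Qed.

Lemma resolution_syzygy i : stable_retract (subm (row_span (D i))) (syzygy M i.+1).
Proof.
elim: i => [|i IH].
  apply: stable_retract_ses resolution_ses0 (syz_ses M 0) _.
  exact: stable_retract_refl.
have [q qs] := row_span_ses (@DD i).
exact: stable_retract_ses qs (syz_ses M i.+1) IH.
Qed.

Hypothesis extM : forall i, (2 <= i)%N -> zero_mod (Ext M R^o i).

(** A row [c] orthogonal to [D i.+2] gives a functional on the image of [D i.+1]. It extends to the
    whole free module because Ext^(i+2)(M, R) = 0, and the coefficients of the extension form
    [a]. *)
Lemma resolution_dual i (c : 'rV[R]_(n i.+2)) :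
  c *m (D i.+2)^T = 0 <-> exists a, c = a *m (D i.+1)^T.
Proof.
split=> [cD|[a ->]]; last first.
  by rewrite -mulmxA -trmx_mul resolution_mul0 trmx0 mulmx0.
have [q qs] := row_span_ses (@DD i).
have /Ext0P e : zero_mod (Ext M R^o i.+2) by exact: extM.
have {}e := stable_retract_extends qs (syz_ses M i.+1) (resolution_syzygy i) e.
have [r [rE rs]] := row_span_cover (D i.+1).
have [f fE] := @rV_linear R _ R^o (c 0).
have [v rv|xi xiE] := @factor_surj _ _ _ _ r f rs.
  have : v *m D i.+1 = 0 by rewrite -rE rv raddf0.
  move=> /DD[a ->]; have : (a *m D i.+2 *m c^T) 0 0 = 0.
    by rewrite -mulmxA -[D i.+2]trmxK -trmx_mul cD trmx0 mulmx0 mxE.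
  by move=> <-; rewrite fE mxE; apply: eq_bigr => j _; rewrite [c^T _ _]mxE.
have [psi psiE] := e xi.
exists (\row_j psi (delta_mx 0 j)); apply/rowP => j.
have := xiE (delta_mx 0 j); rewrite -psiE fE /= rE => E.
transitivity (\sum_(k < n i.+2) (delta_mx 0 j : 'rV[R]_(n i.+2)) 0 k *: (c 0 k : R^o)).
  rewrite (bigD1 j) //= big1 => [|k kj]; last by rewrite mxE (negbTE kj) andbF scale0r.
  by rewrite mxE !eqxx scale1r addr0.
rewrite -E -rowE rV_linearE mxE; apply: eq_bigr => k _.
by rewrite !mxE mulrC.
Qed.

(** Read to the right, the dual complex resolves the cokernel of a transposed matrix [j] steps
    further on. Taking [j] large brings the vanishing of high Ext to bear on the image of the
    transpose of [D i.+1]. *)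
Lemma resolution_dual_syzygy j i :
  stable_retract (subm (row_span (D i.+1)^T))
    (syzygy (quotm (row_span (D (i.+1 + j))^T)) j.+1).
Proof.
elim: j i => [|j IH] i.
  rewrite addn0; apply: stable_retract_ses (quot_ses _) (syz_ses _ 0) _.
  exact: stable_retract_refl.
have [q qs] := row_span_ses (@resolution_dual i).
by rewrite -addSnnS; apply: stable_retract_ses qs (syz_ses _ j.+1) (IH i.+1).
Qed.

End Dual.

Lemma pd_quot_scale k (s : R) : (forall x : R, s * x = 0 -> x = 0) ->
  pd_le 1 (quotm (row_span (s%:M : 'M[R]_k))).
Proof.
move=> sreg.
pose d (i : nat) := match i with 0%N | 1%N => k | _ => 0%N end.
pose D (i : nat) : 'M[R]_(d i.+1, d i) :=
  match i with 0%N => s%:M | _ => 0 end.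
have z0 i (v : 'rV[R]_(d i.+2)) : v = 0 by apply/rowP; case.
have D0 (v : 'rV[R]_k) : v *m s%:M = 0 -> v = 0.
  rewrite mul_mx_scalar => /rowP E; apply/rowP => j; have := E j.
  by rewrite !mxE => /sreg.
have [_ ex0 _ _] := quot_ses (row_span (s%:M : 'M[R]_k)).
unshelve eexists; first apply: (@ProjRes R _ (fun i => 'rV[R]_(d i))
  (fun i => mulmxr (D i)) (projm (row_span (s%:M : 'M[R]_k)))).
- by move=> i; exact: projective_rV.
- by move=> x; have [v ->] := projm_surj x; exists v.
- move=> v; rewrite -(linear0 (projm _)) projm_eq subr0.
  by split=> [/row_spanP//|H]; apply/row_spanP.
- move=> [|i] b; split=> [|[x <-]] /=.
  + by move=> /D0 ->; exists 0; rewrite mul0mx.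
  + by rewrite /= mulmx0 mul0mx.
  + by move=> _; exists 0; rewrite mul0mx (z0 _ b).
  + by rewrite mulmx0.
- by move=> [//|[//|i]] _ v; exact: z0.
Qed.

Lemma torsion_annihilator (S : set R) M : mult_set S -> catM S M ->
  exists2 s, S s & forall m : M, s *: m = 0.
Proof.
move=> [S1 SM] [[n [x gx]] tM].
have /boolp.choice[t tE] : forall i, exists t, S t /\ t *: x i = 0.
  by move=> i; have [t St tx] := tM (x i); exists t.
exists (\prod_i t i).
  by elim/big_ind: _ => // i _; have [] := tE i.
move=> m; have [c ->] := gx m; rewrite scaler_sumr big1 // => i _.
rewrite scalerA mulrC -scalerA (bigD1 i) //= mulrC -scalerA.
by have [_ ->] := tE i; rewrite !scaler0.
Qed.

Lemma row_span_quot_torsion k s (x : quotm (row_span (s%:M : 'M[R]_k))) : s *: x = 0.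
Proof.
have [v ->] := projm_surj x; rewrite -linearZ -(linear0 (projm _)).
apply/projm_eq; rewrite subr0; apply/row_spanP; exists v.
by rewrite mul_mx_scalar.
Qed.

(** [P] is (R/s)^k and [Q] the cokernel. The second syzygy of [Q] is a stable retract of the first
    one of [M], so Ext^(i+1)(Q, R) vanishes with Ext^i(M, R) for i >= 2. Only Ext^2(Q, R) depends on
    the choice of the map into [P]. *)
Lemma embed_catP (S : set R) M :
  noetherian R -> mult_set S -> nonzerodiv_set S ->
  (exists d : nat, forall (i : nat) (N : lmodType R),
     (d < i)%N -> fg_mod N -> zero_mod (Ext N R^o i)) ->
  catC S M ->
  exists (P Q : lmodType R) (f : {linear M -> P}) (q : {linear P -> Q}),
    [/\ injective f, exact_at f q, surjective q, catP S P & catC S Q].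
Proof.
move=> nR mS rS [d extR] [cM extM].
have [n [D [p [ps pD DD]]]] := matrix_resolution nR cM.1.
have [s Ss sM] := torsion_annihilator mS cM.
have sreg x : s * x = 0 -> x = 0 by exact: rS.
(* As [s] kills [M], multiplication by [s] factors through [D 0]. Up to sign, [U] and the [W] in the
   proof of [DUZ] begin a contracting homotopy for [s]. *)
have [U UD] : exists U : 'M[R]_(n 0%N, n 1%N), s%:M = U *m D 0%N.
  have /boolp.choice[u uE] : forall i, exists a, row i (s%:M : 'M[R]_(n 0%N)) = a *m D 0%N.
    by move=> i; apply/pD; rewrite -scalemx1 !linearZ /= sM.
  exists (\matrix_i u i); apply/row_matrixP => i.
  by rewrite row_mul rowK.
have D10 := resolution_mul0 DD 0.
have [k [Z ZE]] := noetherian_kernel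
  (mulmxr (D 1%N)^T : {linear 'rV[R]_(n 1%N) -> 'rV[R]_(n 2%N)}) nR.
have {}ZE (v : 'rV[R]_(n 1%N)) : v *m (D 1%N)^T = 0 <-> exists a, v = a *m Z.
  exact: ZE.
have ZD : D 1%N *m Z^T = 0.
  rewrite -[LHS]trmxK trmx_mul trmxK; apply/trmx_inj; rewrite trmxK trmx0.
  apply/row_matrixP => i; rewrite row0 row_mul; apply/ZE.
  by exists (delta_mx 0 i); rewrite -rowE.
have DUZ : D 0%N *m U *m Z^T = s *: Z^T.
  have [W WE] : exists W : 'M[R]_(n 1%N, n 2%N), D 0%N *m U - s%:M = W *m D 1%N.
    have H i : exists a, row i (D 0%N *m U - s%:M) = a *m D 1%N.
      apply/DD; rewrite -row_mul mulmxBl -mulmxA -UD mul_mx_scalar mul_scalar_mx.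
      by rewrite subrr row0.
    have /boolp.choice[w wE] := H.
    by exists (\matrix_i w i); apply/row_matrixP => i; rewrite row_mul rowK.
  apply/eqP; rewrite -subr_eq0 -mul_scalar_mx -mulmxBl WE -mulmxA ZD mulmx0.
  by [].
(* The rows of Z generate Hom(ker p, R), so the columns of V, taken modulo s,
   generate Hom(M, R/s); sep says that these homomorphisms separate M. *)
pose V := U *m Z^T.
have sep (x : 'rV[R]_(n 0%N)) (r : 'rV[R]_k) : x *m V = s *: r -> exists a, x = a *m D 0%N.
  move=> xV.
  have [q qs] := row_span_ses ZE.
  (* The cokernel of the row span of [Z] in R^(n 1) is a stable retract of a syzygy of index d+1.
     Extending functionals is thus obstructed by an Ext of degree d+2, which is 0. *)
  have e : extends (syz_incl (quotm (row_span (D (1 + d)%N)^T)) d.+1).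
    apply/Ext0P/extR => //; apply: (@surj_fg _ 'rV[R]_(n (1 + d).+1) _ (projm _)).
      by move=> x'; have [v ->] := projm_surj x'; exists v.
    exists (n (1 + d).+1), (fun i => delta_mx 0 i) => v; exists (v 0).
    exact: row_sum_delta.
  have {}e := stable_retract_extends qs (syz_ses _ d.+1)
    (resolution_dual_syzygy ps pD DD extM d 0) e.
  have [h [hE hs]] := row_span_cover Z.
  have [f fE] := @rV_linear R _ R^o (r 0).
  have {}fE b : f b = (r *m b^T) 0 0.
    by rewrite fE mxE; apply: eq_bigr => j _; rewrite [b^T _ _]mxE mulrC.
  have srb b : s *: (r *m b^T) = x *m U *m (b *m Z)^T.
    by rewrite scalemxAl -xV trmx_mul !mulmxA.
  (* By [srb], s r b^T depends only on b Z; as [s] is regular, the functional [f] descends to the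
     row span of [Z]. *)
  have [b hb|xi xiE] := @factor_surj _ _ _ _ h f hs.
    have bZ : b *m Z = 0 by rewrite -hE hb.
    apply: sreg; have : (s *: (r *m b^T)) 0 0 = 0.
      by rewrite srb bZ trmx0 mulmx0 mxE.
    by rewrite mxE fE.
  have [psi psiE] := e xi.
  pose y := \row_j (psi (delta_mx 0 j) : R).
  have psiy c : psi c = (y *m c^T) 0 0.
    rewrite rV_linearE mxE; apply: eq_bigr => j _.
    by rewrite !mxE mulrC.
  (* The row y extends x from the image of the transpose of D 0 to the whole
     of the dual of 'rV_(n 1), hence x = y D 0. *)
  exists y; apply/rowP => j.
  have /ZE[b bE] : (delta_mx 0 j : 'rV[R]_(n 0%N)) *m (D 0%N)^T *m (D 1%N)^T = 0.
    by rewrite -mulmxA -trmx_mul D10 trmx0 mulmx0.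
  have entry (v : 'rV[R]_(n 0%N)) : v 0 j =
      (v *m (delta_mx 0 j : 'rV[R]_(n 0%N))^T) 0 0.
    rewrite mxE (bigD1 j) //= big1 => [|i ij]; last by rewrite !mxE (negbTE ij) andbF mulr0.
    by rewrite !mxE !eqxx mulr1 addr0.
  rewrite [LHS]entry [RHS]entry -mulmxA -[D 0%N]trmxK -trmx_mul bE.
  rewrite -psiy -hE psiE xiE fE.
  apply/eqP; rewrite -subr_eq0; apply/eqP/sreg.
  rewrite mulrBr; have -> : s * (r *m b^T) 0 0 = (s *: (r *m b^T)) 0 0 by rewrite [RHS]mxE.
  rewrite srb -bE trmx_mul trmxK mulmxA -(mulmxA x) -UD mul_mx_scalar.
  by rewrite -scalemxAl [X in _ - X]mxE subrr.
pose sI : 'M[R]_k := s%:M.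
pose P : lmodType R := quotm (row_span sI).
have [v pv|f fE] := @factor_surj _ _ _ _ p (projm (row_span sI) \o mulmxr V) ps.
  have [a ->] := (pD v).1 pv.
  rewrite /= -(linear0 (projm _)); apply/projm_eq; rewrite subr0; apply/row_spanP.
  by exists (a *m Z^T); rewrite mul_mx_scalar scalemxAr -DUZ /V !mulmxA.
pose Q : lmodType R := quotm (image_mod f).
pose q : {linear P -> Q} := projm (image_mod f).
have fI : injective f.
  suff f0 m : f m = 0 -> m = 0.
    by move=> m m' E; apply: subr0_eq; apply: f0; rewrite linearB E subrr.
  have [v <-] := ps m; rewrite fE /= -(linear0 (projm _)) => /projm_eq.
  rewrite subr0 => /row_spanP[r]; rewrite mul_mx_scalar => /esym/sep[a av].
  by apply/pD; exists a.
have qs : surjective q by move=> x; have [v ->] := projm_surj x; exists v.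
have fq : exact_at f q.
  move=> b; rewrite -(linear0 q) projm_eq subr0; split=> [/asboolP//|H].
  exact/asboolP.
have projs : surjective (projm (row_span sI)).
  by move=> x; have [v ->] := projm_surj x; exists v.
have fgP : fg_mod P.
  apply: surj_fg projs _; exists k, (fun i => delta_mx 0 i) => v; exists (v 0).
  exact: row_sum_delta.
have tQ (x : Q) : s *: x = 0.
  have [v <-] := qs x.
  by rewrite -linearZ /= row_span_quot_torsion linear0.
exists P, Q, f, q; split=> //.
  split; last exact: pd_quot_scale.
  by split=> // x; exists s => //; exact: row_span_quot_torsion.
split; first by split; [exact: surj_fg fgP|move=> x; exists s].
(* The rows of [W] span the kernel of R^k -> Q, and those of [Km] span the relations between the
   rows of [W]. Projecting [Km] to its block [D 0] identifies its row span with the kernel of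
   [p]. *)
pose W := col_mx V sI.
pose Km := row_mx (D 0%N) (- Z^T).
have WK (v : 'rV[R]_(n 0%N + k)) : v *m W = 0 <-> exists a, v = a *m Km.
  rewrite -[v]hsubmxK mul_row_col mul_mx_scalar; split.
    set x := lsubmx v; set r := rsubmx v => E.
    have [a xa] : exists a, x = a *m D 0%N.
      by apply: (sep x (- r)); rewrite scalerN; apply/eqP; rewrite -addr_eq0 E.
    exists a; rewrite /Km mul_mx_row -xa; congr row_mx.
    have {}E : s *: (a *m Z^T + r) = 0.
      by rewrite scalerDr scalemxAr -DUZ -[RHS]E xa /V !mulmxA.
    rewrite mulmxN; apply/eqP; rewrite -addr_eq0 addrC; apply/eqP/rowP => j.
    have := congr1 (fun t : 'rV_k => t 0 j) E.
    by rewrite mxE [in RHS]mxE => /sreg ->; rewrite mxE.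
  move=> [a]; rewrite mul_mx_row => /eq_row_mx[-> ->].
  by rewrite /V -mulmxA !(mulmxA (D _)) DUZ mulmxN scalerN scalemxAr subrr.
have [w ws] := row_span_ses WK.
have Wses : ses (val : subm (row_span W) -> 'rV[R]_k) (q \o projm (row_span sI)).
  split; [exact: val_inj| | |exact: projective_rV]; last first.
    by move=> x; have [y <-] := qs x; have [v <-] := projs y; exists v.
  move=> b; split.
    move=> /fq[m]; have [v <-] := ps m; rewrite fE /= => /projm_eq/row_spanP[r rE].
    have bW : b \in row_span W.
      apply/row_spanP; exists (row_mx v (- r)).
      by rewrite mul_row_col mulNmx rE opprB addrC subrK.
    by exists (in_subm bW).
  move=> [y <-]; have /row_spanP[a aE] := valP y; apply/fq; exists (p (lsubmx a)).
  rewrite fE /=; apply/projm_eq; apply/row_spanP; exists (- rsubmx a).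
  rewrite -aE -[X in X *m W]hsubmxK mul_row_col.
  by rewrite opprD addrA subrr sub0r mulNmx.
have S1 : stable_retract (syzygy Q 1) (subm (row_span W)).
  by apply: stable_retract_ses (syz_ses Q 0) Wses _; exact: stable_retract_refl.
have S2 : stable_retract (syzygy Q 2) (subm (row_span Km)).
  exact: stable_retract_ses (syz_ses Q 1) ws S1.
have [i iE] : exists i : {linear subm (row_span Km) -> 'rV[R]_(n 0%N)},
    forall y, i y = val y *m col_mx 1%:M 0.
  by exists (mulmxr (col_mx 1%:M 0) \o (val : subm (row_span Km) -> _)).
have iK a (y : subm (row_span Km)) : val y = a *m Km -> i y = a *m D 0%N.
  by move=> yE; rewrite iE yE mul_mx_row mul_row_col mulmx1 mulmx0 addr0.
have ises : ses i p.
  split=> //; last exact: projective_rV.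
    suff i0 y : i y = 0 -> y = 0.
      by move=> y y' E; apply: subr0_eq; apply: i0; rewrite linearB E subrr.
    have /row_spanP[a aE] := valP y; rewrite (iK a) // => /DD[b bE].
    by apply: val_inj; rewrite -aE bE -mulmxA mul_mx_row D10 mulmxN ZD oppr0 row_mx0 mulmx0.
  move=> v; rewrite pD; split=> [[a ->]|[y <-]].
    have aK : a *m Km \in row_span Km by apply/row_spanP; exists a.
    by exists (in_subm aK); exact: iK.
  by have /row_spanP[a aE] := valP y; exists a; rewrite (iK a).
have S3 : stable_retract (syzygy Q 2) (syzygy M 1).
  apply: stable_retract_trans S2 _.
  by apply: stable_retract_ses ises (syz_ses M 0) _; exact: stable_retract_refl.
have Sj j : stable_retract (syzygy Q j.+2) (syzygy M j.+1).
  elim: j => [//|j IH]; exact: stable_retract_ses (syz_ses _ _) (syz_ses _ _) IH.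
move=> [//|[//|[|j]]] _; last first.
  apply/Ext0P; apply: stable_retract_extends (syz_ses _ _) (syz_ses _ _) (Sj j) _.
  by apply/Ext0P/extM.
apply/Ext0P; apply: stable_retract_extends (syz_ses _ _) ws S1 _ => xi.
have [h [hE hs]] := row_span_cover Km.
(* What remains is Ext^2(Q, R) = 0. The coefficients [z] of [xi] are orthogonal to [D 1] because D 1
   Km = 0, so z = c Z. Since the last [k] columns of [Km] are -Z^T, the functional with column (0,
   -c^T) extends [xi]. *)
pose z := \row_j (xi (h (delta_mx 0 j)) : R).
have xiz v : xi (h v) = (v *m z^T) 0 0.
  rewrite -[LHS]/((xi \o h) v) rV_linearE mxE; apply: eq_bigr => j _.
  by rewrite !mxE.
have [c zc] : exists c, z = c *m Z.
  apply/ZE; apply/rowP => j; 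
  have : xi (h ((delta_mx 0 j : 'rV[R]_(n 2%N)) *m D 1%N)) = 0.
    rewrite (_ : h _ = 0) ?linear0 //; apply: val_inj.
    by rewrite hE -mulmxA mul_mx_row D10 mulmxN ZD oppr0 row_mx0 mulmx0 raddf0.
  rewrite xiz -mulmxA -rowE mxE => E; rewrite [RHS]mxE -[RHS]E.
  by rewrite -[z *m _]trmxK trmx_mul trmxK mxE.
pose psi0 : {linear 'rV[R]_(n 0%N + k) -> 'rV[R]_1} :=
  mulmxr (col_mx 0 (- c^T) : 'M[R]_(n 0%N + k, 1)).
have [|psi psiE] := @linear_ex R 'rV[R]_(n 0%N + k) R^o (fun v => psi0 v 0 0).
  by move=> a u v; rewrite linearP !mxE.
exists psi => y; have [v <-] := hs y; rewrite psiE xiz /= hE mul_mx_row mul_row_col.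
by rewrite mulmx0 add0r mulmxN mulmxN mulNmx opprK zc trmx_mul !mulmxA.
Qed.

End Embedding.

(** * Duality into K / R *)

(* K, seen as an R-module through iota. *)
Definition scalars_mod (R K : comPzRingType) (iota : {rmorphism R -> K}) : Type := K.

Section ScalarsMod.
Variables (R K : comPzRingType) (iota : {rmorphism R -> K}).
Local Notation KR := (scalars_mod iota).
HB.instance Definition _ := GRing.Zmodule.copy KR K.
Definition scalars_scale (a : R) (z : KR) : KR := iota a * z.
Fact scalars_scaleA a b z : scalars_scale a (scalars_scale b z) = scalars_scale (a * b) z.
Proof. by rewrite /scalars_scale rmorphM mulrA. Qed.
Fact scalars_scale1 : left_id 1 scalars_scale.
Proof. by move=> z; rewrite /scalars_scale rmorph1 mul1r. Qed.
Fact scalars_scaleDr : right_distributive scalars_scale +%R.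
Proof. by move=> a y z; rewrite /scalars_scale -mulrDr. Qed.
Fact scalars_scaleDl z : {morph scalars_scale^~ z : a b / a + b}.
Proof. by move=> a b; rewrite /scalars_scale rmorphD mulrDl. Qed.
HB.instance Definition _ := GRing.Zmodule_isLmodule.Build R KR
  scalars_scaleA scalars_scale1 scalars_scaleDr scalars_scaleDl.

Lemma scalars_scaleE (a : R) (z : KR) : a *: z = iota a * z :> K.
Proof. by []. Qed.

Lemma scalars_in : exists f : {linear R^o -> KR}, forall r, f r = iota r.
Proof.
apply: (@linear_ex R R^o KR iota) => a x y.
by rewrite rmorphD rmorphM.
Qed.

Definition integral_at (z : KR) := exists r, z = iota r.

Lemma integral_atD y z : integral_at y -> integral_at z -> integral_at (y + z).
Proof. by move=> [r ->] [s ->]; exists (r + s); rewrite rmorphD. Qed.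

Lemma integral_atN z : integral_at z -> integral_at (- z).
Proof. by move=> [r ->]; exists (- r); rewrite rmorphN. Qed.

Lemma scalars_rV n (f : {linear 'rV[R]_n -> KR}) :
  exists c : 'cV[K]_n, forall v, f v = (map_mx iota v *m c) 0 0 :> K.
Proof.
exists (\col_i f (delta_mx 0 i)) => v; rewrite rV_linearE mxE.
by apply: eq_bigr => i _; rewrite !mxE.
Qed.

Variable S : set R.
Hypotheses (nzS : nonzerodiv_set S) (mS : mult_set S) (locS : is_localization S iota).

Lemma loc_inj : injective iota.
Proof.
move=> x y E; apply: subr0_eq; have [_ _ H] := locS.
have /H[s Ss] : iota (x - y) = 0 by rewrite rmorphB E subrr.
exact: nzS.
Qed.

Lemma loc_reg s (y z : K) : S s -> iota s * y = iota s * z -> y = z.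
Proof.
have [H _ _] := locS => /H[k sk] E.
have F x : x = k * (iota s * x) by rewrite mulrA (mulrC k) sk mul1r.
by rewrite (F y) E -F.
Qed.

(** Elements of [S] act invertibly on K, so the value at [v] is forced to be chi(a) / s whenever i a
    = s v. *)
Lemma scalars_extend (A V : lmodType R) (i : {linear A -> V}) (chi : {linear A -> KR}) :
  injective i -> (forall v, exists2 s, S s & exists a, i a = s *: v) ->
  exists mu : {linear V -> KR}, forall a, mu (i a) = chi a.
Proof.
move=> iI tV.
have H v : exists z : KR, forall s a, S s -> i a = s *: v -> s *: z = chi a.
  have [s Ss [a aE]] := tV v; have [/(_ s Ss)[k sk] _ _] := locS.
  exists (k * chi a) => t b St bE.
  apply: (loc_reg Ss); rewrite scalars_scaleE mulrCA (mulrA (iota s)) sk mul1r.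
  rewrite -[LHS]/(t *: chi a) -[RHS]/(s *: chi b) -!linearZ; congr (chi _).
  by apply: iI; rewrite !linearZ /= aE bE !scalerA mulrC.
have /boolp.choice[mu0 muE] := H.
have [|mu mu0E] := @linear_ex R V KR mu0; last first.
  exists mu => a; rewrite mu0E -[LHS]scale1r; apply: muE; last by rewrite scale1r.
  by have [] := mS.
move=> c u v; have [s Ss [a aE]] := tV u; have [t St [b bE]] := tV v.
have Sst : S (s * t) by have [_] := mS; exact.
apply: (loc_reg Sst); rewrite -[LHS]/((s * t) *: mu0 _) -[RHS]/((s * t) *: (c *: mu0 u + mu0 v)).
rewrite (muE _ _ ((c * t) *: a + s *: b) Sst); last first.
  rewrite linearD !linearZ /= aE bE scalerDr !scalerA; congr (_ *: _ + _).
  by rewrite mulrC mulrCA mulrC.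
rewrite linearD !linearZ /= -(muE _ _ _ Ss aE) -(muE _ _ _ St bE).
by rewrite scalerDr !scalerA (_ : c * t * s = s * t * c) // mulrC mulrCA mulrC.
Qed.

(* Surjectivity of Hom(P, K/R) -> Hom(im u, K/R), stated for lifts to K of the
   homomorphisms to K/R. *)
Lemma ext2_lift n (N P U : lmodType R) (pi : {linear 'rV[R]_n -> P})
    (u : {linear U -> P}) (h : {linear P -> N}) (b : {linear U -> 'rV[R]_n})
    (w : {linear U -> KR}) :
  projective U -> surjective pi -> surjective h -> exact_at u h ->
  (forall x, pi (b x) = u x) -> torsion_mod S N -> zero_mod (Ext N R^o 2) ->
  (forall x, u x = 0 -> integral_at (w x)) ->
  exists mu : {linear 'rV[R]_n -> KR},
    (forall v, pi v = 0 -> integral_at (mu v)) /\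
    (forall x, integral_at (mu (b x) - w x)).
Proof.
move=> PU pis hs uh pib tN /Ext0P e wint.
have hps : surjective (h \o pi).
  by move=> x; have [y <-] := hs x; have [v <-] := pis y; exists v.
have ses1 := kernel_ses (@projective_rV R n) hps.
pose Om := subm (kernel (h \o pi)).
have SR : stable_retract Om (syzygy N 1).
  by apply: stable_retract_ses ses1 (syz_ses N 0) _; exact: stable_retract_refl.
(* [Om] is b(U) + ker pi, covered by U x F. The map equal to [w] on U and 0 on F is integral on the
   kernel of this cover, and Ext^2(N, R) = 0 extends that restriction to an integral [th].
   Subtracting [th] lets the map descend to [Om], whence it extends to R^n because [N] is
   torsion. *)
pose F := free_mod R (subm (kernel pi)).
have PW : projective (U * F)%type by apply: projective_prod => //; exact: free_projective.
pose q0 : {linear (U * F)%type -> 'rV[R]_n} :=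
  (b \o fst) \+ ((val : subm (kernel pi) -> _) \o (free_cover (subm (kernel pi)) \o snd)).
have pik (y : subm (kernel pi)) : pi (val y) = 0 by exact/asboolP/(valP y).
have [x|q qE] := @factor_inj R _ _ _ (val : Om -> 'rV[R]_n) q0 val_inj.
  have kx : q0 x \in kernel (h \o pi).
    apply/asboolP; rewrite /= linearD pib /= pik addr0.
    by apply/uh; exists x.1.
  by exists (in_subm kx).
have qs : surjective q.
  move=> v; have /asboolP/uh[x xE] := valP v.
  have kv : val v - b x \in kernel pi.
    by apply/asboolP; rewrite linearB pib xE subrr.
  have [y yE] := free_cover_surj (in_subm kv : subm (kernel pi)).
  by exists (x, y); apply: val_inj; rewrite qE /= yE /= addrC subrK.
have ses2 := kernel_ses PW qs.
have {}e := stable_retract_extends ses2 (syz_ses N 1) SR e.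
have [io ioE] := scalars_in.
have ioI : injective io by move=> x y; rewrite !ioE => /loc_inj.
have [z|xi xiE] := @factor_inj R _ _ _ io
    ((w \o fst) \o (val : subm (kernel q) -> _)) ioI.
  have [|r rE] := wint (val z).1; last by exists r; rewrite ioE.
  have qz : q (val z) = 0 by exact/asboolP/(valP z).
  have : q0 (val z) = 0 by rewrite -qE qz.
  by move=> /(congr1 pi); rewrite /= linear0 linearD pib /= pik addr0.
have [th thE] := e xi.
have [z qz|chi chiE] := @factor_surj R _ _ _ q ((w \o fst) \- (io \o th)) qs.
  have kz : z \in kernel q by exact/asboolP.
  have := xiE (in_subm kz); rewrite -thE /= => ->.
  by rewrite subrr.
have [v|mu muE] := @scalars_extend _ _ (val : Om -> 'rV[R]_n) chi val_inj.
  have [s Ss sE] := tN (h (pi v)); exists s => //.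
  have kv : s *: v \in kernel (h \o pi) by apply/asboolP; rewrite linearZ.
  by exists (in_subm kv).
exists mu; split=> [v pv|x].
  have kv : v \in kernel pi by exact/asboolP.
  have [y yE] := free_cover_surj (in_subm kv : subm (kernel pi)).
  have -> : v = val (q (0, y)) by rewrite qE /= yE /= linear0 add0r.
  rewrite muE chiE /= linear0 sub0r; apply: integral_atN.
  by exists (th (0, y)); rewrite ioE.
have -> : b x = val (q (x, 0)) by rewrite qE /= !linear0 addr0.
rewrite muE chiE /= addrAC subrr sub0r; apply: integral_atN.
by exists (th (x, 0)); rewrite ioE.
Qed.

Section DualRep.
Variable M : lmodType R.

(* Under Ext^1(M, R) = Hom(M, K/R), the map w is a lift to K, on the free cover
   of M, of the homomorphism M -> K/R corresponding to x. *)
Definition dual_rep (x : dual M) (w : free_mod R M -> KR) :=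
  exists u : subm (cocycle R^o (free_res M) 1),
    x = projm _ u /\ forall y, iota (val u y) = w (syzygy_d M 0 y).

Lemma dual_rep0 : dual_rep 0 (fun=> 0).
Proof.
exists 0; split; first by rewrite linear0.
by move=> y; rewrite -[val _ _]/(0 : R) rmorph0.
Qed.

Lemma dual_repD a x w x' w' : dual_rep x w -> dual_rep x' w' ->
  dual_rep (a *: x + x') (fun y => a *: w y + w' y).
Proof.
move=> [u [-> uE]] [u' [-> uE']]; exists (a *: u + u').
split; first by rewrite linearP.
by move=> y; rewrite -uE -uE' -[val _ _]/(a * val u y + val u' y) rmorphD rmorphM.
Qed.

Lemma dual_rep_sum k (a : 'I_k -> R) (z : 'I_k -> dual M) (w : 'I_k -> free_mod R M -> KR) :
  (forall i, dual_rep (z i) (w i)) ->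
  dual_rep (\sum_i a i *: z i) (fun y => \sum_i a i *: w i y).
Proof.
elim: k a z w => [|k IH] a z w H.
  have -> : (fun y => \sum_(i < 0) a i *: w i y) = fun=> 0.
    by apply/funext => y; rewrite big_ord0.
  by rewrite big_ord0; exact: dual_rep0.
have -> : (fun y => \sum_(i < k.+1) a i *: w i y) = (fun y => a ord0 *: w ord0 y +
    \sum_(i < k) a (lift ord0 i) *: w (lift ord0 i) y).
  by apply/funext => y; rewrite big_ord_recl.
rewrite big_ord_recl; apply: dual_repD => //.
exact: (IH (fun i => a (lift ord0 i)) (fun i => z (lift ord0 i)) (fun i => w (lift ord0 i))).
Qed.

Lemma dual_rep_ker x (w : {linear free_mod R M -> KR}) y : dual_rep x w ->
  free_cover M y = 0 -> integral_at (w y).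
Proof.
move=> [u [_ uE]] y0; have [_ /(_ y)[+ _] _ _] := syz_ses M 0.
move=> /(_ y0)[a <-]; have [t <-] := free_cover_surj a.
by exists (val u t); rewrite uE.
Qed.

Hypothesis tM : torsion_mod S M.

Lemma syzygy_torsion v : exists2 s, S s & exists a, syz_incl M 0 a = s *: v.
Proof.
have [s Ss sE] := tM (free_cover M v); exists s => //.
by have [_ ex _ _] := syz_ses M 0; apply/ex; rewrite linearZ.
Qed.

Lemma dual_rep_lift x : exists w : {linear free_mod R M -> KR}, dual_rep x w.
Proof.
have [u ->] := projm_surj x; have [xi xiE] := cocycle_factor u.
have [io ioE] := scalars_in.
have [w wE] := scalars_extend (io \o xi) (@val_inj _ _ _ : injective (syz_incl M 0)) syzygy_torsion.
exists w, u; split=> // y.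
by rewrite -xiE -ioE -[RHS]/(w (syz_incl M 0 (free_cover _ y))) wE.
Qed.

Lemma dual_rep_ex (w : {linear free_mod R M -> KR}) :
  (forall y, free_cover M y = 0 -> integral_at (w y)) -> exists x, dual_rep x w.
Proof.
move=> wint; have [io ioE] := scalars_in.
have ioI : injective io by move=> x y; rewrite !ioE => /loc_inj.
have [_ ex _ _] := syz_ses M 0.
have [z|xi xiE] := @factor_inj R _ _ _ io (w \o syz_incl M 0) ioI.
  have [|r rE] := wint (syz_incl M 0 z); last by exists r; rewrite ioE /= rE.
  by apply/ex; exists z.
have fc := cocycle_syzygy xi.
exists (projm _ (in_subm fc)), (in_subm fc); split=> // y.
by rewrite -[LHS]/(iota (xi (free_cover _ y))) -ioE xiE.
Qed.

(** As [M] is torsion, [w] is determined by its restriction to the first syzygy. So an integral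
    functional bounding the cocycle must agree with [w], and conversely an integral [w] bounds
    it. *)
Lemma dual_rep_eq0 x (w : {linear free_mod R M -> KR}) : dual_rep x w ->
  x = 0 <-> forall y, integral_at (w y).
Proof.
move=> [u [-> uE]]; rewrite -(linear0 (projm _)) projm_eq subr0.
split=> [/asboolP[g gE] y|wint].
  have [s Ss [a aE]] := syzygy_torsion y; exists (g y).
  apply: (loc_reg Ss); rewrite -[LHS]/(s *: w y) -linearZ -aE -rmorphM.
  rewrite -[s * _]/(s *: (g y : R^o)) -linearZ -aE.
  have [t <-] := free_cover_surj a.
  by rewrite -[LHS]/(w (syzygy_d M 0 t)) -uE gE.
have [io ioE] := scalars_in.
have ioI : injective io by move=> y z; rewrite !ioE => /loc_inj.
have [z|g gE] := @factor_inj R _ _ _ io w ioI.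
  by have [r rE] := wint z; exists r; rewrite ioE.
apply/asboolP; exists g; apply/funext => y; apply: loc_inj.
by rewrite uE /= -ioE gE.
Qed.
End DualRep.
End ScalarsMod.

Lemma stable_retract_projective (R : comPzRingType) (A B : lmodType R) :
  stable_retract A B -> projective B -> projective A.
Proof.
move=> [f [g [Q [r [s [PQ E]]]]]] PB A' B' p u ps.
have [a aE] := PB _ _ p (u \o g) ps; have [b bE] := PQ _ _ p (u \o s) ps.
exists ((a \o f) \+ (b \o r)) => x.
by rewrite /= linearD aE bE /= -linearD -E.
Qed.

(** * The four-term sequence *)

Section Main.
Variables (R : comPzRingType) (S : set R) (K : comPzRingType)
  (iota : {rmorphism R -> K}).
Hypotheses (nR : noetherian R) (mS : mult_set S) (nzS : nonzerodiv_set S)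
  (locS : is_localization S iota).
Local Notation KR := (scalars_mod iota).
Local Notation "A ^i" := (map_mx iota A) (at level 2, format "A ^i").

(** The kernel of [pi] is projective because [P] has a resolution of length 1, so its cover by the
    rows of [X] has a section [tau]. As some [s] kills [P], tau(s v) makes sense for every [v] in
    R^n; its matrix divided by [s] is [Y], and [E] records [tau] on the rows of [X]. *)
Lemma catP_lattice (P : lmodType R) n (pi : {linear 'rV[R]_n -> P}) :
  surjective pi -> catP S P ->
  exists k (X : 'M[R]_(k, n)) (Y : 'M[K]_(n, k)) (E : 'M[R]_k),
    [/\ Y *m X^i = 1%:M, X^i *m Y = E^i
      & forall v, pi v = 0 <-> exists a, v = a *m X].
Proof.
move=> pis [cP [r rz]].
have [k [X XE]] := noetherian_kernel pi nR.
have d0I : injective (pr_d r 0).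
  suff d0 x : pr_d r 0 x = 0 -> x = 0.
    by move=> x y xy; apply: subr0_eq; apply: d0; rewrite linearB xy subrr.
  by move=> /(@pr_d_exact _ _ r 0)[y <-]; rewrite (rz 2%N isT y) linear0.
have rses : ses (pr_d r 0) (pr_aug r).
  by split=> //; [exact: pr_aug_exact|exact: pr_aug_surj|exact: pr_projective].
have lses := kernel_ses (@projective_rV R n) pis.
have PL : projective (subm (kernel pi)).
  apply: (@stable_retract_projective _ _ (pr_mod r 1)); last exact: pr_projective.
  exact: stable_retract_ses lses rses (stable_retract_refl P).
have [v|h hE] := @factor_inj R _ _ _ (val : subm (kernel pi) -> 'rV[R]_n)
    (mulmxr X : {linear 'rV[R]_k -> 'rV[R]_n}) val_inj.
  have kv : v *m X \in kernel pi by apply/asboolP/XE; exists v.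
  by exists (in_subm kv).
have hs : surjective h.
  move=> y; have /asboolP/XE[a aE] := valP y; exists a; apply: val_inj.
  by rewrite hE; exact: esym aE.
have [tau tauE] := PL _ _ h idfun hs.
have tauX y : tau y *m X = val y by rewrite -[RHS](congr1 val (tauE y)) hE.
have [s Ss sP] := torsion_annihilator mS cP.
have sL v : s *: v \in kernel pi by apply/asboolP; rewrite linearZ /= sP.
have [t tE] : exists t : {linear 'rV[R]_n -> 'rV[R]_k}, forall v, t v = tau (in_subm (sL v)).
  apply: linear_ex => a x y; rewrite -linearP; congr (tau _); apply: val_inj => /=.
  by rewrite scalerDr !scalerA mulrC.
pose T := \matrix_i t (delta_mx 0 i).
have tT v : t v = v *m T by exact: rV_linear_mx.
have TX : T *m X = s%:M.
  apply/row_matrixP => i; rewrite row_mul rowK tE tauX /=.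
  by rewrite -scalemx1 linearZ /= row1.
have XK i : row i X \in kernel pi.
  by apply/asboolP/XE; exists (delta_mx 0 i); rewrite -rowE.
pose E := \matrix_i tau (in_subm (XK i)).
have XT : X *m T = s *: E.
  apply/row_matrixP => i; rewrite row_mul -tT tE [RHS]linearZ /= rowK -[RHS]linearZ.
  by congr (tau _); apply: val_inj.
have [/(_ s Ss)[c sc] _ _] := locS.
exists k, X, (c *: T^i), E; split=> //.
  rewrite -scalemxAl -map_mxM TX map_scalar_mx scale_scalar_mx.
  by rewrite mulrC sc.
by rewrite -scalemxAr -map_mxM XT map_mxZ scalerA mulrC sc scale1r.
Qed.

Lemma fracFitt_lattice (P : lmodType R) n (x : 'I_n -> P) k (X : 'M[R]_(k, n)) :
  generates x -> (forall a, relations x a <-> exists b, a = b *m X) ->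
  fracFitt iota P = delta iota (rspan iota X^i).
Proof.
move=> gx xX; rewrite (fracFittE iota gx); congr (delta _ _); apply/seteqP.
split=> [_ [a /xX[b ->] <-]|_ [b _ <-]].
  by exists b => //; rewrite map_mxM.
by exists (b *m X); [apply/xX; exists b|rewrite map_mxM].
Qed.

Lemma catP_Omega_inv (P : lmodType R) : catP S P ->
  exists J, Omega_inv iota (fracFitt iota P) J.
Proof.
move=> cP; have [n [x [pi [gx piE pis]]]] := fg_cover cP.1.1.
have [k [X [Y [E [YX XY XE]]]]] := catP_lattice pis cP.
rewrite (@fracFitt_lattice _ _ x _ X gx) => [|a]; last by rewrite -XE piE.
exists (delta iota (rspan iota Y^T)); split; first exact: Omega_delta_rspan.
exact: delta_dual_mul YX XY.
Qed.

Lemma integral_row n (z : 'rV[K]_n) :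
  (forall v : 'rV[R]_n, integral_at (iota := iota) ((v^i *m z^T) 0 0)) ->
  exists c, z = c^i.
Proof.
move=> H; have /boolp.choice[c cE] : forall j, exists r, z 0 j = iota r.
  move=> j; have [r rE] := H (delta_mx 0 j); exists r; rewrite -rE.
  by rewrite map_delta_mx -rowE !mxE.
by exists (\row_j c j); apply/rowP => j; rewrite !mxE.
Qed.

Lemma functional_linear (A : lmodType R) n (b : {linear A -> 'rV[R]_n}) (l : 'cV[K]_n) :
  exists w : {linear A -> KR}, forall y, w y = ((b y)^i *m l) 0 0.
Proof.
apply: (@linear_ex R A KR (fun y => ((b y)^i *m l) 0 0)) => a x y.
by rewrite linearP map_mxD map_mxZ mulmxDl -scalemxAl mxE [X in X + _]mxE.
Qed.

Lemma image_cover (A B : lmodType R) (g : {linear A -> B}) :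
  exists g0 : {linear A -> subm (image_mod g)},
    (forall x, val (g0 x) = g x) /\ surjective g0.
Proof.
have [x|g0 g0E] := @factor_inj R _ _ _ (val : subm (image_mod g) -> B) g val_inj.
  have gx : g x \in image_mod g by apply/asboolP; exists x.
  by exists (in_subm gx).
exists g0; split=> // y; have /asboolP[x xE] := valP y.
by exists x; apply: val_inj; rewrite g0E.
Qed.

Lemma rspan_trE k n (Y : 'M[K]_(n, k)) (z : 'rV[K]_n) :
  rspan iota Y^T z <-> exists c : 'cV[R]_k, z^T = Y *m c^i.
Proof.
split=> [[a _ <-]|[c zE]].
  by exists a^T; rewrite trmx_mul trmxK map_trmx.
by exists c^T => //; rewrite -[RHS]trmxK zE trmx_mul map_trmx.
Qed.

Section FourTerm.
Variables (M P2 P1 N : lmodType R) (f : {linear M -> P2}) (g : {linear P2 -> P1})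
  (h : {linear P1 -> N}).
Hypotheses (fI : injective f) (fg : exact_at f g) (gh : exact_at g h)
  (hs : surjective h).
Hypotheses (cM : catC S M) (cN : catC S N) (cI : catC S (subm (image_mod g))).
Variables (m n k2 k1 : nat) (x1 : 'I_n -> P1)
  (p2 : {linear 'rV[R]_m -> P2}) (p1 : {linear 'rV[R]_n -> P1}).
Hypotheses (p2s : surjective p2) (p1s : surjective p1)
  (gx1 : generates x1) (p1E : forall v, p1 v = \sum_i v 0 i *: x1 i).
Variables (X2 : 'M[R]_(k2, m)) (Y2 : 'M[K]_(m, k2)) (E2 : 'M[R]_k2)
  (X1 : 'M[R]_(k1, n)) (Y1 : 'M[K]_(n, k1)) (E1 : 'M[R]_k1) (C : 'M[R]_(m, n)).
Hypotheses (YX2 : Y2 *m X2^i = 1%:M) (XY2 : X2^i *m Y2 = E2^i)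
  (ker2 : forall v, p2 v = 0 <-> exists a, v = a *m X2)
  (YX1 : Y1 *m X1^i = 1%:M) (XY1 : X1^i *m Y1 = E1^i)
  (ker1 : forall v, p1 v = 0 <-> exists a, v = a *m X1)
  (gC : forall v, g (p2 v) = p1 (v *m C)).

Lemma fracFitt_coker :
  fracFitt iota N = delta iota (rspan iota (col_mx X1^i C^i)).
Proof.
rewrite -map_col_mx; apply: (@fracFitt_lattice _ _ (h \o x1)).
  move=> y; have [z <-] := hs y; have [c ->] := gx1 z; exists c.
  by rewrite linear_sum; apply: eq_bigr => i _; rewrite linearZ_LR.
move=> a; have -> : relations (h \o x1) a <-> h (p1 a) = 0.
  rewrite p1E linear_sum /relations /=.
  by under [X in _ <-> X = _]eq_bigr do rewrite linearZ_LR.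
split=> [/gh[y]|[b ->]].
  have [v <-] := p2s y; rewrite gC => /esym/eqP; rewrite -subr_eq0 -linearB.
  move=> /eqP/ker1[b bE]; exists (row_mx b v).
  by rewrite mul_row_col -bE subrK.
apply/gh; exists (p2 (rsubmx b)); rewrite gC.
rewrite -[b in RHS]hsubmxK mul_row_col linearD.
have -> : p1 (lsubmx b *m X1) = 0 by apply/ker1; exists (lsubmx b).
by rewrite add0r.
Qed.

(** The values of [mu] on the rows of [X] form the integral column [c], and Y X = 1 recovers [mu]
    from them. This is the description of the dual lattice by [Y]. *)
Lemma integral_functional l l' (X : 'M[R]_(l, l')) (Y : 'M[K]_(l', l)) (P : lmodType R)
    (p : {linear 'rV[R]_l' -> P}) (mu : {linear 'rV[R]_l' -> KR}) :
  Y *m X^i = 1%:M -> (forall v, p v = 0 <-> exists a, v = a *m X) ->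
  (forall v, p v = 0 -> integral_at (mu v)) ->
  exists c : 'cV[R]_l, forall v, mu v = (v^i *m (Y *m c^i)) 0 0.
Proof.
move=> YX ker muint; have [nu nuE] := scalars_rV mu.
have [c cE] : exists c, (X^i *m nu)^T = c^i.
  apply: integral_row => v; rewrite trmxK mulmxA -map_mxM.
  have /muint : p (v *m X) = 0 by apply/ker; exists v.
  by rewrite nuE.
exists c^T => v; rewrite nuE -map_trmx -cE trmxK (mulmxA Y) YX.
by rewrite mul1mx.
Qed.

(** [fracFitt_quot] is applied to the dual lattice spanned by the columns of [Y2], of which M^* is a
    quotient. Generation comes from Ext^2(im g, R) = 0, which extends every M -> K/R to P2; the
    relations come from Ext^2(N, R) = 0. *)
Lemma fracFitt_dual : fracFitt iota (dual M) =
  OmegaM iota (delta iota (rspan iota (col_mx 1%:M (Y1^T *m (C^i)^T))))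
    (delta iota (rspan iota X2^i)).
Proof.
have [be beE] := @free_projective R M _ _ p2 (f \o free_cover M) p2s.
have tM : torsion_mod S M by exact: cM.1.2.
have be_ker y : free_cover M y = 0 -> exists a, be y = a *m X2.
  by move=> y0; apply/ker2; rewrite beE /= y0 linear0.
(* Column [i] of [Y2] is a functional on R^m integral on the kernel of [p2]; it induces P2 -> K/R,
   whose restriction to [M] is the class [z]. *)
have H i : exists z : dual M, dual_rep z (fun y => ((be y)^i *m col i Y2) 0 0 : KR).
  have [w wE] := functional_linear be (col i Y2).
  have [|z zw] := dual_rep_ex nzS locS (w := w); last first.
    by exists z; move: zw; congr dual_rep; apply/funext.
  move=> y /be_ker[a aE]; rewrite wE aE map_mxM colE !mulmxA -(mulmxA a^i) XY2.
  by exists ((a *m E2) 0 i); rewrite -colE -map_mxM !mxE.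
have /boolp.choice[z zE] := H.
have zsum (a : 'rV[R]_k2) : exists2 w : {linear free_mod R M -> KR},
    dual_rep (\sum_i a 0 i *: z i) w &
    forall y, w y = ((be y)^i *m (Y2 *m (a^i)^T)) 0 0.
  have [w wE] := functional_linear be (Y2 *m (a^i)^T); exists w => //.
  have := dual_rep_sum (a 0) zE; congr dual_rep; apply/funext => y.
  rewrite wE mulmxA [RHS]mxE; apply: eq_bigr => i _.
  rewrite scalars_scaleE mulrC [(a^i)^T _ _]mxE [a^i _ _]mxE; congr (_ * _).
  by rewrite [LHS]mxE [RHS]mxE; apply: eq_bigr => j _; rewrite [col i Y2 _ _]mxE.
have [g0 [g0E g0s]] := image_cover g.
have fg0 : exact_at f g0.
  move=> b; rewrite -(fg b) -g0E; split=> [->//|E].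
  by apply: val_inj; rewrite E.
have eI : zero_mod (Ext (subm (image_mod g)) R^o 2) by exact: cI.2.
have eN : zero_mod (Ext N R^o 2) by exact: cN.2.
have fc0 : exact_at (f \o free_cover M) g0.
  move=> b; rewrite fg0; split=> [[y <-]|[y <-]]; last by exists (free_cover M y).
  by have [t <-] := free_cover_surj y; exists t.
have gz : generates z.
  move=> x; have [w xw] := dual_rep_lift mS locS tM x.
  have [y|mu [mu0 mub]] := @ext2_lift R K iota S nzS mS locS _ _ _ _ p2
      (f \o free_cover M) g0 be w (@free_projective _ _) p2s g0s fc0 beE cI.1.2 eI.
    move=> /= fy; have /(dual_rep_ker xw) : free_cover M y = 0; last by [].
    by apply: fI; rewrite fy linear0.
  have [c cE] := integral_functional YX2 ker2 mu0.
  exists (c^T 0); apply: subr0_eq.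
  have [w' w'z w'E] := zsum c^T.
  have xz := dual_repD (-1) w'z xw.
  have w'f : (fun y => (-1) *: w' y + w y) = w \- w'.
    by apply/funext => y; rewrite scaleN1r addrC.
  rewrite w'f in xz.
  have : -1 *: \sum_i c^T 0 i *: z i + x = 0.
    apply/(dual_rep_eq0 nzS locS tM xz) => y; rewrite /= -opprB; apply: integral_atN.
    by rewrite w'E -map_trmx trmxK -cE; exact: mub.
  by rewrite scaleN1r addrC.
pose G := rspan iota (col_mx 1%:M (Y1^T *m (C^i)^T)).
have GP v : G v <-> exists (r : 'rV[R]_m) (c : 'cV[R]_k1),
    v^T = (r^i)^T + C^i *m Y1 *m c^i.
  split=> [[a _ <-]|[r [c vE]]].
    exists (lsubmx a), (rsubmx a)^T.
    rewrite -{1}[a]hsubmxK map_row_mx mul_row_col mulmx1 linearD /= !trmx_mul !trmxK.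
    by rewrite !map_trmx.
  exists (row_mx r c^T) => //; rewrite map_row_mx mul_row_col mulmx1.
  rewrite -[RHS]trmxK vE linearD /= trmxK !trmx_mul map_trmx.
  by rewrite !map_trmx.
have X2C : exists B, X2 *m C = B *m X1.
  have H2 i : exists b, row i X2 *m C = b *m X1.
    apply/ker1; rewrite -gC; have -> : p2 (row i X2) = 0; last by rewrite linear0.
    by apply/ker2; exists (delta_mx 0 i); rewrite -rowE.
  have /boolp.choice[b bE] := H2.
  by exists (\matrix_i b i); apply/row_matrixP => i; rewrite !row_mul rowK.
have -> : rspan iota X2^i = rspan iota (X2^i)^T^T by rewrite trmxK.
apply: (@fracFitt_quot _ _ _ _ _ Y2^T (X2^i)^T E2^T _ _ _ z) => //.
- by rewrite -trmx_mul YX2 trmx1.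
- by rewrite -trmx_mul XY2 map_trmx.
- by exists 0 => //; rewrite map_mx0 mul0mx.
- move=> v /GP[r [c vE]]; apply/rspan_trE; have [B BE] := X2C.
  exists (X2 *m r^T + B *m E1 *m c).
  rewrite map_mxD !map_mxM -map_trmx -XY1 !mulmxA -map_mxM -BE.
  by rewrite vE -[LHS]mul1mx -YX2 map_mxM mulmxDr mulmxDr !mulmxA.
(* If the functional Y2 a^T is integral on [M], then modulo R it factors through the image of [g]
   and extends to P1 -> K/R, that is, to a functional Y1 c on R^n. It differs from the pullback of
   Y1 c along [C] by an integral row [r], so it lies in [G]. *)
move=> a; rewrite -/G; split=> [az|/GP[r [c aE]]].
  have [w0 + w0E] := zsum a; rewrite az => za.
  have wint y : integral_at (((be y)^i *m (Y2 *m (a^i)^T)) 0 0 : KR).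
    by rewrite -w0E; exact: (dual_rep_eq0 nzS locS tM za).1.
  have [w wE] := functional_linear (idfun : {linear 'rV[R]_m -> _}) (Y2 *m (a^i)^T).
  have gp : exact_at (g \o p2) h.
    move=> b; rewrite gh; split=> [[y <-]|[y <-]]; last by exists (p2 y).
    by have [t <-] := p2s y; exists t.
  have [v|mu [mu0 mub]] := @ext2_lift R K iota S nzS mS locS _ _ _ _ p1
      (g \o p2) h (mulmxr C) w (@projective_rV R m) p1s hs gp
      (fun v => esym (gC v)) cN.1.2 eN.
    move=> /= /fg[q qE]; have [y yE] := free_cover_surj q.
    have /ker2[c cE] : p2 (v - be y) = 0 by rewrite linearB beE /= yE qE subrr.
    have -> : v = be y + c *m X2 by rewrite -cE addrC subrK.
    rewrite wE map_mxD mulmxDl mxE; apply: integral_atD; first exact: wint.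
    exists ((c *m E2 *m a^T) 0 0).
    by rewrite map_trmx !mulmxA map_mxM -(mulmxA c^i) XY2 -!map_mxM mxE.
  have [c cE] := integral_functional YX1 ker1 mu0.
  have [r rE] : exists r, ((Y2 *m (a^i)^T) - C^i *m Y1 *m c^i)^T = r^i.
    apply: integral_row => v; have := integral_atN (mub v).
    rewrite opprB wE cE /= map_mxM trmxK mulmxBr [X in _ -> integral_at X]mxE.
    by rewrite [(- (_ *m _)) _ _]mxE !mulmxA.
  apply/GP; exists r, c.
  by rewrite trmx_mul trmxK -rE trmxK subrK.
have [w xz wE] := zsum a; apply/(dual_rep_eq0 nzS locS tM xz) => y.
have [b bE] : exists b, be y *m C = b *m X1.
  by apply/ker1; rewrite -gC beE; apply/fg; exists (free_cover M y).
move: aE; rewrite trmx_mul trmxK => aE.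
rewrite wE aE mulmxDr mxE; apply: integral_atD.
  by exists ((be y *m r^T) 0 0); rewrite map_trmx -map_mxM mxE.
exists ((b *m E1 *m c) 0 0).
by rewrite !mulmxA -map_mxM bE map_mxM -(mulmxA b^i) XY1 -!map_mxM mxE.
Qed.

End FourTerm.

(** Apart from the common factor Fitt(P2), the claim is that [J] times [dN] is [dG]. Here
    [delta_coker_dual] sends [J] times [dN] into [dG], and [delta_dual_coker] sends [dG] times [d1]
    into [dN]. *)
Lemma shift2_value_dual (M : lmodType R) (X : set K) :
  catC S M -> shift2_value S iota (fracFitt iota) M X ->
  X = fracFitt iota (dual M).
Proof.
move=> cM [P2 [P1 [N [f [g [h [[fI fg gh hs] [[cP2 cP1 cN cI] [J [[OJ JE] ->]]]]]]]]]].
have [m [x2 [p2 [gx2 p2E p2s]]]] := fg_cover cP2.1.1.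
have [n [x1 [p1 [gx1 p1E p1s]]]] := fg_cover cP1.1.1.
have [k2 [X2 [Y2 [E2 [YX2 XY2 ker2]]]]] := catP_lattice p2s cP2.
have [k1 [X1 [Y1 [E1 [YX1 XY1 ker1]]]]] := catP_lattice p1s cP1.
have [C0 C0E] := @projective_rV R m _ _ p1 (g \o p2) p1s.
pose C := \matrix_i C0 (delta_mx 0 i).
have gC v : g (p2 v) = p1 (v *m C) by rewrite -rV_linear_mx C0E.
have F1 : fracFitt iota P1 = delta iota (rspan iota X1^i).
  by apply: (fracFitt_lattice gx1) => a; rewrite -ker1 p1E.
have F2 : fracFitt iota P2 = delta iota (rspan iota X2^i).
  by apply: (fracFitt_lattice gx2) => a; rewrite -ker2 p2E.
rewrite (fracFitt_dual fI fg gh hs cM cN cI p2s p1s YX2 XY2 ker2 YX1 XY1 ker1 gC).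
rewrite (fracFitt_coker gh hs p2s gx1 p1E ker1 gC) F2.
rewrite F1 in JE.
set dN := delta iota (rspan iota (col_mx X1^i C^i)).
set dG := delta iota (rspan iota (col_mx 1%:M _)).
set d1 := delta iota (rspan iota X1^i) in JE *.
(* [J] is only known as an inverse of [d1]; since its products with [d1] lie in R, [delta_dual_elim]
   places it in the delta of the dual lattice. *)
have Jd j : J j -> delta iota (rspan iota Y1^T) j.
  move=> Jj; apply: (delta_dual_elim YX1 XY1) => x y dx dy.
  have : OmegaM iota d1 J (x * j) by exact: OmegaM_in.
  rewrite JE => -[r _ rE]; rewrite mulrAC -rE; exact: RspanZ.
apply/seteqP; split.
  apply: OmegaM_min => u b Hu Hb; move: u Hu.
  apply: OmegaM_mulr => j a Jj da; rewrite mulrAC.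
  apply: OmegaM_in => //; rewrite mulrC.
  exact: (delta_coker_dual XY1 Hb (Jd _ Jj)).
apply: OmegaM_min => c a dc da.
(* Writing 1 as a combination of products x j with x in [d1] moves x next to c, where c x falls into
   [dN]. *)
have : OmegaM iota d1 J 1 by rewrite JE; exists 1; rewrite ?rmorph1.
rewrite -[c * a]mul1r; move: 1; apply: OmegaM_mulr => x j dx Jj.
have -> : x * j * (c * a) = j * a * (c * x).
  by rewrite mulrACA (mulrC x c) (mulrC (c * x)).
apply: OmegaM_in; first exact: OmegaM_in.
exact: (delta_dual_coker XY1).
Qed.

End Main.

Theorem proposition4p7 (R : comPzRingType) (S : set R)
    (K : comPzRingType) (iota : {rmorphism R -> K}) :
  noetherian R -> mult_set S -> nonzerodiv_set S ->
  is_localization S iota ->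
  (exists d : nat, forall (i : nat) (M : lmodType R),
     (d < i)%N -> fg_mod M -> zero_mod (Ext M R^o i)) ->
  forall M : lmodType R, catC S M ->
    shift2 S iota (fracFitt iota) M = fracFitt iota (dual M).
Proof.
move=> nR mS nzS locS extR M cM.
(* The four-term sequence is spliced from an embedding of [M] and one of its cokernel [Q]; the image
   of the middle map is isomorphic to [Q], hence lies in the category C. *)
have [P2 [Q [f [q [fI fq qs cP2 cQ]]]]] := embed_catP nR mS nzS extR cM.
have [P1 [N [f' [h [f'I f'h hs cP1 cN]]]]] := embed_catP nR mS nzS extR cQ.
have [J JE] := catP_Omega_inv nR mS locS cP1.
have val0 : shift2_value S iota (fracFitt iota) M
    (OmegaM iota (OmegaM iota J (fracFitt iota P2)) (fracFitt iota N)).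
  exists P2, P1, N, f, (f' \o q), h; split; last first.
    split; last by exists J.
    split=> //; have [g0 [g0E g0s]] := image_cover (f' \o q).
    have [w qw|e eE] := @factor_surj R _ _ _ q g0 qs.
      by apply: val_inj; rewrite g0E /= qw linear0.
    have [z|e' e'E] := @factor_inj R _ _ _ f' (val : subm (image_mod (f' \o q)) -> P1) f'I.
      by have /asboolP[y yE] := valP z; exists (q y).
    have e'K : cancel e' e.
      move=> z; apply: val_inj; have [y yE] := qs (e' z).
      by rewrite -yE eE g0E /= yE e'E.
    have es : surjective e by move=> z; exists (e' z).
    split=> [|[//|i] i1].
      split; first exact: surj_fg es cQ.1.1.
      move=> z; have [y <-] := es z; have [s Ss sE] := cQ.1.2 y.
      by exists s => //; rewrite -linearZ /= sE linear0.
    by apply: stable_retract_Ext0 (iso_stable_retract e'K) _; exact: cQ.2.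
  split=> //.
    move=> b; rewrite -fq /=; split=> [|->]; last by rewrite linear0.
    by move=> E; apply: f'I; rewrite E linear0.
  move=> b; rewrite f'h; split=> [[y <-]|[y <-]]; last by exists (q y).
  by have [t <-] := qs y; exists t.
have valE X : shift2_value S iota (fracFitt iota) M X -> X = fracFitt iota (dual M).
  exact: shift2_value_dual.
have {}val0 : shift2_value S iota (fracFitt iota) M (fracFitt iota (dual M)).
  by rewrite -(valE _ val0).
by apply: get_unique => [|Y [/valE]].
Qed.
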